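(* Let $\varphi:D\to D$ be an analytic self-map of the open unit disc $D$. The composition operator $C_\varphi f=f\circ\varphi$ is an isometry on the harmonic Bloch space $HB(1)$ if and only if $\varphi(0)=0$ and at least one of the following holds: (1) $\varphi$ is a rotation; (2) for every $a\in D$ there exists a sequence $\{z_n\}$ in $D$ such that $|z_n|\to1$, $\varphi(z_n)\to a$ and $\tau_\varphi(z_n)\to1$. Moreover, whenever $\varphi'$ is bounded on $D$ or $\varphi$ is univalent, $C_\varphi$ is an isometry on $HB(1)$ if and only if $\varphi$ is a rotation.
   Context: $D=\{z\in\mathbb{C}:|z|<1\}$. For a continuously differentiable complex-valued function $f$ on $D$ ($z=x+iy$), $f_z=\frac12(f_x-if_y)$ and $f_{\bar z}=\frac12(f_x+if_y)$. A twice continuously differentiable $f=u+iv:D\to\mathbb{C}$ is harmonic if $\Delta u=\Delta v=0$. The harmonic Bloch space $HB(1)$ is the complex Banach space of complex-valued harmonic functions $f$ on $D$ with finite norm $$\|f\|=|f(0)|+\sup_{z\in D}(1-|z|^2)[|f_z(z)|+|f_{\bar z}(z)|].$$ $C_\varphi$ is an isometry if $\|f\circ\varphi\|=\|f\|$ for all $f\in HB(1)$. A rotation is a map $\varphi(z)=\lambda z$ with $|\lambda|=1$. For an analytic self-map $\varphi$ of $D$, $$\tau_\varphi(z)=\frac{(1-|z|^2)|\varphi'(z)|}{1-|\varphi(z)|^2},\quad z\in D.$$ *)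

(* Defs.v *)
From Stdlib Require Import Reals.
From Coquelicot Require Import Coquelicot.
Open Scope R_scope.

(* Functions on the unit disc are represented by total functions [C -> C];
   every notion below depends only on their values on [unit_disc], which is open. *)
Definition unit_disc (z : C) : Prop := Cmod z < 1.

Definition re_part (f : C -> C) (x y : R) : R := Re (f (x, y)).
Definition im_part (f : C -> C) (x y : R) : R := Im (f (x, y)).

Definition C_dx (f : C -> C) (z : C) : C :=
  (Derive (fun x => re_part f x (Im z)) (Re z),
   Derive (fun x => im_part f x (Im z)) (Re z)).

Definition C_dy (f : C -> C) (z : C) : C :=
  (Derive (fun y => re_part f (Re z) y) (Im z),
   Derive (fun y => im_part f (Re z) y) (Im z)).

Definition C_dz (f : C -> C) (z : C) : C :=
  (/ 2 * (C_dx f z - Ci * C_dy f z))%C.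

Definition C_dzbar (f : C -> C) (z : C) : C :=
  (/ 2 * (C_dx f z + Ci * C_dy f z))%C.

(* [ex_diff_n u 2 x y] says that the partial derivatives of [u] of order at
   most 2 exist and are continuous at [(x, y)]; holding throughout the disc, it
   is twice continuous differentiability there. *)
Definition C2_on_disc (u : R -> R -> R) : Prop :=
  forall x y : R, unit_disc (x, y) -> ex_diff_n u 2 x y.

Definition laplacian (u : R -> R -> R) (x y : R) : R :=
  partial_derive 2 0 u x y + partial_derive 0 2 u x y.

Definition harmonic_on_disc (f : C -> C) : Prop :=
  C2_on_disc (re_part f) /\ C2_on_disc (im_part f) /\
  forall x y : R, unit_disc (x, y) ->
    laplacian (re_part f) x y = 0 /\ laplacian (im_part f) x y = 0.

Definition HB_norm (f : C -> C) : Rbar :=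
  Rbar_plus (Cmod (f 0))
    (Lub_Rbar (fun r : R => exists z : C, unit_disc z /\
       r = (1 - Cmod z ^ 2) * (Cmod (C_dz f z) + Cmod (C_dzbar f z)))).

Definition HB (f : C -> C) : Prop :=
  harmonic_on_disc f /\ is_finite (HB_norm f).

Definition composition_isometry (phi : C -> C) : Prop :=
  forall f : C -> C, HB f -> HB_norm (fun z => f (phi z)) = HB_norm f.

(* Analytic means complex differentiable at every point of the disc. *)
Definition analytic_self_map (phi : C -> C) : Prop :=
  (forall z : C, unit_disc z -> unit_disc (phi z)) /\
  (forall z : C, unit_disc z -> @ex_derive C_AbsRing C_NormedModule phi z).

Definition is_rotation (phi : C -> C) : Prop :=
  exists lambda : C, Cmod lambda = 1 /\
    forall z : C, unit_disc z -> phi z = (lambda * z)%C.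

Definition tau (phi : C -> C) (z : C) : R :=
  (1 - Cmod z ^ 2) * Cmod (C_derive phi z) / (1 - Cmod (phi z) ^ 2).

Definition bounded_derivative (phi : C -> C) : Prop :=
  exists M : R, forall z : C, unit_disc z -> Cmod (C_derive phi z) <= M.

Definition univalent (phi : C -> C) : Prop :=
  forall z w : C, unit_disc z -> unit_disc w -> phi z = phi w -> z = w.

(* Main.v *)
Require Import Defs.
From Stdlib Require Import Reals Lra Lia Psatz ClassicalEpsilon.
From Coquelicot Require Import Coquelicot.
Open Scope R_scope.

(* By the chain rule, passing from f to f o phi multiplies the Bloch density
   (1-|z|^2)(|f_z|+|f_zbar|) by tau_phi(z) and evaluates it at phi(z); Schwarz-Pick gives
   tau_phi <= 1, so sequences with phi(z_n) -> a and tau_phi(z_n) -> 1 force equality of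
   seminorms.  Conversely, the test functions z + c give phi(0) = 0, and the Moebius
   involution L_a, whose density is 1-|L_a|^2, yields z_n with tau_phi(z_n) -> 1 and
   phi(z_n) -> a.  If phi is not a rotation, tau_phi is bounded away from 1 on compact
   sets, hence |z_n| -> 1.  For a = 0 this is impossible if phi' is bounded, and also if
   phi is univalent, since then phi stays away from 0 near the boundary.

   Since analytic only means differentiable, the function theory rests on Goursat's
   bisection argument, applied in logarithmic polar coordinates to the closed form
   v ds + u dt: the mean of u over a circle does not depend on the radius.  This gives
   the mean value property at a centre where only continuity is known, hence Cauchy
   estimates by applying it to (f(z) - f(0))/z. *)

(** * Complex derivatives *)

(** The mean value property compares a circle with its centre only, and this shapes the function
    theory. An estimate at another point [a] is moved to the origin: [recentred phi a] fixes [0] and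
    its derivative there has modulus [tau phi a], so a derivative bound at the origin is already
    Schwarz-Pick everywhere. The Schwarz lemma, usually drawn from the maximum principle, is then
    recovered by integrating Schwarz-Pick along a radius. Only after that is [psi z / z] known to be
    bounded by 1 off the origin, so that equality in the mean value bound yields the rigidity that
    singles out rotations. Continuity of [phi'], which compactness arguments for [tau] require,
    comes from the Cauchy estimate for the difference of two translates of [phi].

    Logarithmic polar coordinates turn an annulus into a rectangle, the only kind of domain the
    bisection handles; the two sides that come from the cut cancel by periodicity. *)

(* Coquelicot equips C with two uniform structures, the product one and that of [Cmod];
   this form is equivalent to [is_derive] for both. *)
Definition cdiff (f : C -> C) (z l : C) : Prop :=
  forall eps, 0 < eps -> exists d, 0 < d /\ forall w, Cmod (w - z) < d ->
    Cmod (f w - f z - l * (w - z)) <= eps * Cmod (w - z).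

Lemma cdiff_domin f z l :
  cdiff f z l <->
  is_domin (Ku := C_AbsRing) (Kv := C_AbsRing) (U := AbsRing_NormedModule C_AbsRing)
   (V := AbsRing_NormedModule C_AbsRing)
   (locally (T := AbsRing_UniformSpace C_AbsRing) z)
    (fun y => minus y z)
    (fun y => minus (minus (f y) (f z)) (scal (minus y z) l)).
Proof.
  assert (E : forall w, (f w - f z - l * (w - z))%C =
     minus (minus (f w) (f z)) (scal (minus w z : AbsRing_NormedModule C_AbsRing) (l : AbsRing_NormedModule C_AbsRing))).
  { intros w. unfold minus, scal; simpl. unfold plus, opp, mult; simpl. ring. }
  split.
  - intros H [eps He]. destruct (H eps He) as [d [Hd H']].
    exists (mkposreal d Hd). intros w Hw. specialize (H' w Hw). rewrite E in H'. exact H'.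
  - intros H eps He. destruct (H (mkposreal eps He)) as [d H'].
    exists d. split. apply cond_pos. intros w Hw. rewrite E. exact (H' w Hw).
Qed.

Lemma cdiff_is_derive f z l :
  @is_derive C_AbsRing C_NormedModule f z l <-> cdiff f z l.
Proof.
  rewrite cdiff_domin. split.
  - intros [_ H]. apply H. now intros P HP.
  - intros H. split.
    apply (is_linear_scal_l (K := C_AbsRing) (V := C_NormedModule) l).
    intros x Hx. apply (is_filter_lim_locally_unique (K := C_AbsRing) (V := AbsRing_NormedModule C_AbsRing)) in Hx. subst x. exact H.
Qed.

(** The sum, product and chain rules are applied over [AbsRing_NormedModule C_AbsRing], whereas
    analyticity of [phi] is expressed over [C_NormedModule]. Passing through [cdiff] connects the
    two. *)
Lemma cdiff_is_derive_abs f z l :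
  @is_derive C_AbsRing (AbsRing_NormedModule C_AbsRing) f z l <-> cdiff f z l.
Proof.
  rewrite cdiff_domin. split.
  - intros [_ H]. apply H. now intros P HP.
  - intros H. split.
    apply (is_linear_scal_l (K := C_AbsRing) (V := AbsRing_NormedModule C_AbsRing) l).
    intros x Hx. apply (is_filter_lim_locally_unique (K := C_AbsRing) (V := AbsRing_NormedModule C_AbsRing)) in Hx. subst x. exact H.
Qed.

Lemma cdiff_C_derive f z l : cdiff f z l -> C_derive f z = l.
Proof. intros H. apply is_C_derive_unique. now apply cdiff_is_derive. Qed.

Lemma ex_derive_cdiff f z :
  @ex_derive C_AbsRing C_NormedModule f z -> cdiff f z (C_derive f z).
Proof. intros [l H]. apply cdiff_is_derive in H. now rewrite (cdiff_C_derive _ _ _ H). Qed.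

Lemma cdiff_id z : cdiff (fun w => w) z 1.
Proof. apply cdiff_is_derive_abs. apply (is_derive_id (K := C_AbsRing)). Qed.

Lemma cdiff_const c z : cdiff (fun _ => c) z 0.
Proof. apply cdiff_is_derive_abs. apply (is_derive_const (K := C_AbsRing) (V := AbsRing_NormedModule C_AbsRing)). Qed.

Lemma cdiff_plus f g z l m : cdiff f z l -> cdiff g z m -> cdiff (fun w => f w + g w)%C z (l + m).
Proof. rewrite <- !cdiff_is_derive_abs. apply (is_derive_plus (K := C_AbsRing) (V := AbsRing_NormedModule C_AbsRing)). Qed.

Lemma cdiff_minus f g z l m : cdiff f z l -> cdiff g z m -> cdiff (fun w => f w - g w)%C z (l - m).
Proof. rewrite <- !cdiff_is_derive_abs. apply (is_derive_minus (K := C_AbsRing) (V := AbsRing_NormedModule C_AbsRing)). Qed.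

Lemma cdiff_mult f g z l m : cdiff f z l -> cdiff g z m -> cdiff (fun w => f w * g w)%C z (l * g z + f z * m).
Proof.
  rewrite <- !cdiff_is_derive_abs. intros H H'.
  apply (is_derive_mult (K := C_AbsRing) f g z l m H H' Cmult_comm).
Qed.

Lemma cdiff_comp f g z l m : cdiff f (g z) l -> cdiff g z m -> cdiff (fun w => f (g w)) z (m * l).
Proof.
  rewrite <- !cdiff_is_derive_abs. intros H H'.
  apply (is_derive_comp (K := C_AbsRing) (V := AbsRing_NormedModule C_AbsRing) f g z l m H H').
Qed.

Lemma cdiff_ext_loc f g z l :
  (exists d, 0 < d /\ forall w, Cmod (w - z) < d -> f w = g w) ->
  cdiff f z l -> cdiff g z l.
Proof.
  intros [d [Hd E]] H eps He. destruct (H eps He) as [d' [Hd' H']].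
  exists (Rmin d d'). split. now apply Rmin_pos.
  intros w Hw. rewrite <- (E w), <- (E z). apply H'.
  apply Rlt_le_trans with (1 := Hw), Rmin_r.
  replace (z - z)%C with (RtoC 0) by ring. now rewrite Cmod_0.
  apply Rlt_le_trans with (1 := Hw), Rmin_l.
Qed.

Lemma Cmod_minus_sym (a b : C) : Cmod (a - b) = Cmod (b - a).
Proof. rewrite <- Cmod_opp. f_equal. ring. Qed.

Lemma Cmod_triangle_rev (a b : C) : Cmod a - Cmod b <= Cmod (a - b).
Proof.
  pose proof (Cmod_triangle (a - b) b) as H.
  replace (a - b + b)%C with a in H by ring. lra.
Qed.

Lemma Cmod_triangle_minus (a b : C) : Cmod (a - b) <= Cmod a + Cmod b.
Proof. unfold Cminus. rewrite <- (Cmod_opp b). apply Cmod_triangle. Qed.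

Lemma cdiff_inv (z : C) : z <> 0 -> cdiff Cinv z (- / (z * z)).
Proof.
  intros Hz eps He. assert (Hm := proj1 (Cmod_gt_0 z) Hz).
  set (m := Cmod z) in *.
  (* The remainder of the expansion is [(w - z)^2 / (z^2 w)]. The first bound gives [|w| > m / 2],
     and the second then makes the remainder at most [eps * |w - z|]. *)
  exists (Rmin (m / 2) (eps * (m * m * m / 2))). split.
  apply Rmin_pos. lra. apply Rmult_lt_0_compat; [lra|].
  assert (0 < m * m) by nra. assert (0 < m * m * m) by nra. lra.
  intros w Hw.
  assert (H1 : Cmod (w - z) < m / 2) by (apply Rlt_le_trans with (1 := Hw), Rmin_l).
  assert (H2 : Cmod (w - z) < eps * (m * m * m / 2)) by (apply Rlt_le_trans with (1 := Hw), Rmin_r).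
  assert (H3 : m / 2 < Cmod w).
  { pose proof (Cmod_triangle_rev z w). rewrite Cmod_minus_sym in H1. unfold m in *. lra. }
  assert (Hw0 : w <> 0). { apply Cmod_gt_0. lra. }
  replace (/ w - / z - - / (z * z) * (w - z))%C with ((w - z) * ((w - z) / (z * z * w)))%C
   by (field; auto).
  rewrite Cmod_mult, Rmult_comm. apply Rmult_le_compat_r. apply Cmod_ge_0.
  rewrite Cmod_div. 2: { repeat apply Cmult_neq_0; auto. }
  rewrite !Cmod_mult. fold m.
  apply Rmult_le_reg_r with (m * m * Cmod w). { assert (0 < m * m) by nra. nra. }
  unfold Rdiv. rewrite Rmult_assoc, Rinv_l, Rmult_1_r. 2: { assert (0 < m * m) by nra. nra. }
  apply Rlt_le. apply Rlt_le_trans with (1 := H2).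
  apply Rmult_le_compat_l. lra. assert (0 < m * m) by nra. nra.
Qed.

Definition ccont (g : C -> C) (z : C) : Prop :=
  forall eps, 0 < eps -> exists d, 0 < d /\ forall w, Cmod (w - z) < d -> Cmod (g w - g z) < eps.

Lemma cdiff_ccont f z l : cdiff f z l -> ccont f z.
Proof.
  intros H eps He. destruct (H 1 Rlt_0_1) as [d [Hd H']].
  pose proof (Cmod_ge_0 l) as Hl.
  assert (Hk : 0 < eps / (Cmod l + 1)) by (apply Rdiv_lt_0_compat; lra).
  exists (Rmin d (eps / (Cmod l + 1))). split. now apply Rmin_pos.
  intros w Hw. specialize (H' w (Rlt_le_trans _ _ _ Hw (Rmin_l _ _))).
  assert (H2 := Rlt_le_trans _ _ _ Hw (Rmin_r _ _)).
  replace (f w - f z)%C with ((f w - f z - l * (w - z)) + l * (w - z))%C by ring.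
  apply Rle_lt_trans with (1 := Cmod_triangle _ _). rewrite Cmod_mult.
  apply Rmult_lt_compat_r with (r := Cmod l + 1) in H2. 2: lra.
  unfold Rdiv in H2. rewrite Rmult_assoc, Rinv_l in H2 by lra. lra.
Qed.

Lemma im_le_Cmod (c : C) : Rabs (Im c) <= Cmod c.
Proof. apply Rle_trans with (2 := Rmax_Cmod c). apply Rmax_r. Qed.

Lemma Cmod_le_2Rmax (x : C) : Cmod x <= 2 * Rmax (Rabs (Re x)) (Rabs (Im x)).
Proof.
  apply Rle_trans with (1 := Cmod_2Rmax x).
  apply Rmult_le_compat_r. apply Rle_trans with (2 := Rmax_l _ _), Rabs_pos.
  pose proof (sqrt_sqrt 2). pose proof (sqrt_pos 2). nra.
Qed.

(** Cauchy-Riemann in total-derivative form: multiplication by [l] has real part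
    [Re l dx - Im l dy]. The error in [differentiable_pt_lim] is measured in the maximum norm, and
    the factor 2 lost in the comparison is why [eps / 2] is used. *)
Lemma cdiff_differentiable_re f x y l : cdiff f (x, y) l ->
  differentiable_pt_lim (re_part f) x y (Re l) (- Im l).
Proof.
  intros H [eps He]. destruct (H (eps / 2)) as [d [Hd H']]. lra.
  assert (Hd2 : 0 < d / 2) by lra.
  exists (mkposreal _ Hd2). simpl. intros u v Hu Hv.
  assert (Hm : Cmod ((u, v) - (x, y))%C <= 2 * Rmax (Rabs (u - x)) (Rabs (v - y)))
    by exact (Cmod_le_2Rmax ((u, v) - (x, y))%C).
  assert (Hr := Rmax_lub_lt _ _ _ Hu Hv).
  specialize (H' (u, v)). unfold re_part.
  eapply Rle_trans; [|eapply Rle_trans; [apply H'|]].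
  - eapply Rle_trans; [|apply re_le_Cmod]. right. apply f_equal. unfold Re, Im. simpl. ring.
  - lra.
  - apply Rmult_le_compat_l with (r := eps / 2) in Hm; lra.
Qed.

Lemma cdiff_differentiable_im f x y l : cdiff f (x, y) l ->
  differentiable_pt_lim (im_part f) x y (Im l) (Re l).
Proof.
  intros H [eps He]. destruct (H (eps / 2)) as [d [Hd H']]. lra.
  assert (Hd2 : 0 < d / 2) by lra.
  exists (mkposreal _ Hd2). simpl. intros u v Hu Hv.
  assert (Hm : Cmod ((u, v) - (x, y))%C <= 2 * Rmax (Rabs (u - x)) (Rabs (v - y)))
    by exact (Cmod_le_2Rmax ((u, v) - (x, y))%C).
  assert (Hr := Rmax_lub_lt _ _ _ Hu Hv).
  specialize (H' (u, v)). unfold im_part.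
  eapply Rle_trans; [|eapply Rle_trans; [apply H'|]].
  - eapply Rle_trans; [|apply im_le_Cmod]. right. apply f_equal. unfold Re, Im. simpl. ring.
  - lra.
  - apply Rmult_le_compat_l with (r := eps / 2) in Hm; lra.
Qed.

(** * Closed forms on rectangles *)

Lemma nested_intervals (a b : nat -> R) :
  (forall n, a n <= a (S n)) -> (forall n, b (S n) <= b n) -> (forall n, a n <= b n) ->
  exists x, forall n, a n <= x <= b n.
Proof.
  intros Ha Hb Hab.
  assert (Ha' : forall n m, (n <= m)%nat -> a n <= a m).
  { intros n m H. induction H. lra. specialize (Ha m). lra. }
  assert (Hb' : forall n m, (n <= m)%nat -> b m <= b n).
  { intros n m H. induction H. lra. specialize (Hb m). lra. }
  assert (Hmn : forall n m, a n <= b m).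
  { intros n m. destruct (Nat.le_ge_cases n m) as [H|H].
    - apply Rle_trans with (2 := Hab m). now apply Ha'.
    - apply Rle_trans with (1 := Hab n). now apply Hb'. }
  destruct (completeness (fun r => exists n, r = a n)) as [x [Hx Hl]].
  - exists (b O). intros r [n ->]. apply Hmn.
  - now exists (a O), O.
  - exists x. intros n. split.
    + apply Hx. now exists n.
    + apply Hl. intros r [m ->]. apply Hmn.
Qed.

Lemma half_pow_small (L d : R) : 0 < d -> exists n, L * (/ 2) ^ n < d.
Proof.
  intros Hd. pose proof (Rabs_pos L).
  assert (Hk : 0 < d / (Rabs L + 1)) by (apply Rdiv_lt_0_compat; lra).
  destruct (pow_lt_1_zero (/ 2)) with (y := d / (Rabs L + 1)) as [n Hn]; auto.
  rewrite Rabs_pos_eq; lra.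
  exists n. specialize (Hn n (Nat.le_refl n)).
  assert (Hp : 0 < (/ 2) ^ n) by (apply pow_lt; lra).
  rewrite Rabs_pos_eq in Hn by lra.
  apply Rmult_lt_compat_r with (r := Rabs L + 1) in Hn. 2: lra.
  unfold Rdiv in Hn. rewrite Rmult_assoc, Rinv_l in Hn by lra.
  pose proof (Rle_abs L). nra.
Qed.

(* A bad box has a bad quarter; the nested bad quarters shrink to a point. *)
Lemma rectangle_bisection (P : R -> R -> R -> R -> Prop) (a0 b0 c0 d0 : R) :
  a0 <= b0 -> c0 <= d0 ->
  (forall a b c d, a0 <= a -> a <= b -> b <= b0 -> c0 <= c -> c <= d -> d <= d0 ->
    P a ((a + b) / 2) c ((c + d) / 2) -> P ((a + b) / 2) b c ((c + d) / 2) ->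
    P a ((a + b) / 2) ((c + d) / 2) d -> P ((a + b) / 2) b ((c + d) / 2) d ->
    P a b c d) ->
  (forall x y, a0 <= x <= b0 -> c0 <= y <= d0 -> exists delta, 0 < delta /\
    forall a b c d, a0 <= a -> b <= b0 -> c0 <= c -> d <= d0 ->
      a <= x <= b -> c <= y <= d -> b - a < delta -> d - c < delta -> P a b c d) ->
  P a0 b0 c0 d0.
Proof.
  intros Hab0 Hcd0 Hsplit Hloc. apply NNPP. intros Hbad.
  pose (bad := fun q : (R * R) * (R * R) =>
    let '((a, b), (c, d)) := q in
    (a0 <= a /\ a <= b /\ b <= b0 /\ c0 <= c /\ c <= d /\ d <= d0) /\ ~ P a b c d).
  assert (Hstep : forall q, bad q -> exists q', bad q' /\
    fst (fst q) <= fst (fst q') /\ snd (fst q') <= snd (fst q) /\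
    fst (snd q) <= fst (snd q') /\ snd (snd q') <= snd (snd q) /\
    snd (fst q') - fst (fst q') = (snd (fst q) - fst (fst q)) / 2 /\
    snd (snd q') - fst (snd q') = (snd (snd q) - fst (snd q)) / 2).
  { intros [[a b] [c d]] [H1 H2]. simpl.
    apply NNPP. intros Hno. apply H2.
    apply Hsplit; try tauto;
    (apply NNPP; intros Hq; apply Hno);
    [ exists ((a, (a + b) / 2), (c, (c + d) / 2)) | exists (((a + b) / 2, b), (c, (c + d) / 2))
    | exists ((a, (a + b) / 2), ((c + d) / 2, d)) | exists (((a + b) / 2, b), ((c + d) / 2, d)) ];
    unfold bad; simpl; repeat split; try assumption; lra. }
  (* Boxes are bundled with the proof that they are bad, so that the recursion can choose a bad
     quarter at every stage. *)
  pose (next := fun q : {q | bad q} =>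
    let s := constructive_indefinite_description _ (Hstep (proj1_sig q) (proj2_sig q)) in
    exist bad (proj1_sig s) (proj1 (proj2_sig s))).
  assert (Hnext : forall q,
    fst (fst (proj1_sig q)) <= fst (fst (proj1_sig (next q))) /\ snd (fst (proj1_sig (next q))) <= snd (fst (proj1_sig q)) /\
    fst (snd (proj1_sig q)) <= fst (snd (proj1_sig (next q))) /\ snd (snd (proj1_sig (next q))) <= snd (snd (proj1_sig q)) /\
    snd (fst (proj1_sig (next q))) - fst (fst (proj1_sig (next q))) = (snd (fst (proj1_sig q)) - fst (fst (proj1_sig q))) / 2 /\
    snd (snd (proj1_sig (next q))) - fst (snd (proj1_sig (next q))) = (snd (snd (proj1_sig q)) - fst (snd (proj1_sig q))) / 2).
  { intros q. unfold next. simpl. destruct constructive_indefinite_description. simpl. tauto. }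
  assert (Hq0 : bad ((a0, b0), (c0, d0))) by (unfold bad; repeat split; auto; lra).
  pose (s := fix s n := match n with O => exist bad _ Hq0 | S n => next (s n) end).
  set (a := fun n => fst (fst (proj1_sig (s n)))).
  set (b := fun n => snd (fst (proj1_sig (s n)))).
  set (c := fun n => fst (snd (proj1_sig (s n)))).
  set (d := fun n => snd (snd (proj1_sig (s n)))).
  assert (Hs : forall n, a n <= a (S n) /\ b (S n) <= b n /\ c n <= c (S n) /\ d (S n) <= d n /\
     b (S n) - a (S n) = (b n - a n) / 2 /\ d (S n) - c (S n) = (d n - c n) / 2).
  { intros n. apply (Hnext (s n)). }
  assert (Hn : forall n, (a0 <= a n /\ a n <= b n /\ b n <= b0 /\ c0 <= c n /\ c n <= d n /\ d n <= d0)
     /\ ~ P (a n) (b n) (c n) (d n)).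
  { intros n. unfold a, b, c, d. destruct (s n) as [[[? ?] [? ?]] H]. exact H. }
  assert (Hw : forall n, b n - a n = (b0 - a0) * (/ 2) ^ n /\ d n - c n = (d0 - c0) * (/ 2) ^ n).
  { induction n as [|n IH].
    - unfold a, b, c, d; simpl. lra.
    - destruct (Hs n) as (_ & _ & _ & _ & -> & ->). simpl. destruct IH as [-> ->]. lra. }
  destruct (nested_intervals a b) as [x Hx]; try (intros n; destruct (Hs n); destruct (Hn n); tauto).
  destruct (nested_intervals c d) as [y Hy]; try (intros n; destruct (Hs n); destruct (Hn n); tauto).
  destruct (Hloc x y) as [delta [Hd Hdelta]].
  { destruct (Hn O), (Hx O). lra. } { destruct (Hn O), (Hy O). lra. }
  destruct (half_pow_small (Rmax (b0 - a0) (d0 - c0)) delta Hd) as [n Hsmall].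
  assert (Hp : 0 < (/ 2) ^ n) by (apply pow_lt; lra).
  pose proof (Rmax_l (b0 - a0) (d0 - c0)). pose proof (Rmax_r (b0 - a0) (d0 - c0)).
  destruct (Hn n) as [? HnP]. destruct (Hw n). apply HnP. apply Hdelta; try tauto; try apply Hx; try apply Hy.
  apply Rle_lt_trans with (2 := Hsmall). rewrite H2. apply Rmult_le_compat_r; lra.
  apply Rle_lt_trans with (2 := Hsmall). rewrite H3. apply Rmult_le_compat_r; lra.
Qed.

Lemma continuity_2d_continuous_l (f : R -> R -> R) (x y : R) :
  continuity_2d_pt f x y -> continuous (fun u => f u y) x.
Proof.
  intros H P [eps HP]. destruct (H eps) as [d Hd]. exists d. intros u Hu.
  apply HP. apply Hd. exact Hu. rewrite Rminus_diag, Rabs_R0. apply cond_pos.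
Qed.

Lemma continuity_2d_continuous_r (f : R -> R -> R) (x y : R) :
  continuity_2d_pt f x y -> continuous (fun v => f x v) y.
Proof.
  intros H P [eps HP]. destruct (H eps) as [d Hd]. exists d. intros u Hu.
  apply HP. apply Hd. rewrite Rminus_diag, Rabs_R0. apply cond_pos. exact Hu.
Qed.

Lemma ex_RInt_continuous_le (f : R -> R) (a b : R) :
  a <= b -> (forall x, a <= x <= b -> continuous f x) -> ex_RInt f a b.
Proof.
  intros Hab H. apply (ex_RInt_continuous (V := R_CompleteNormedModule)). intros x.
  rewrite Rmin_left, Rmax_right by assumption. apply H.
Qed.

Lemma RInt_near_const (f : R -> R) (a b k e : R) :
  a <= b -> ex_RInt f a b -> (forall x, a <= x <= b -> Rabs (f x - k) <= e) ->
  Rabs (RInt f a b - k * (b - a)) <= (b - a) * e.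
Proof.
  intros Hab Hf H.
  assert (E : RInt (fun x => f x - k) a b = RInt f a b - k * (b - a)).
  { rewrite (RInt_minus f (fun _ => k)). 2: assumption. 2: apply ex_RInt_const.
    rewrite RInt_const. unfold minus, plus, opp, scal; simpl. unfold mult; simpl. ring. }
  rewrite <- E. apply abs_RInt_le_const; try assumption.
  apply (ex_RInt_minus f (fun _ => k)). assumption. apply ex_RInt_const.
Qed.

(** The counterclockwise boundary integral of [P dx + Q dy]. Opposite sides share one integral sign,
    so that an affine form has constant integrands. *)
Definition rectangle_integral (P Q : R -> R -> R) (a b c d : R) : R :=
  RInt (fun x => P x c - P x d) a b + RInt (fun y => Q b y - Q a y) c d.

(* [P dx + Q dy] is closed; the partial derivatives need not be continuous. *)
Definition closed_form_on (P Q : R -> R -> R) (a0 b0 c0 d0 : R) : Prop :=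
  forall x y, a0 <= x <= b0 -> c0 <= y <= d0 ->
    exists px py qx qy, differentiable_pt_lim P x y px py /\
      differentiable_pt_lim Q x y qx qy /\ py = qx.

Lemma ex_RInt_horizontal (P Q : R -> R -> R) (a0 b0 c0 d0 : R) a b c d :
  closed_form_on P Q a0 b0 c0 d0 ->
  a0 <= a -> a <= b -> b <= b0 -> c0 <= c <= d0 -> c0 <= d <= d0 ->
  ex_RInt (fun x => P x c - P x d) a b.
Proof.
  intros Hdiff **. apply ex_RInt_continuous_le; auto. intros x Hx.
  apply (continuous_minus (V := R_NormedModule)).
  - destruct (Hdiff x c) as (px & py & qx & qy & H4 & _); try lra.
    apply (continuity_2d_continuous_l P), differentiable_continuity_pt. now exists px, py.
  - destruct (Hdiff x d) as (px & py & qx & qy & H4 & _); try lra.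
    apply (continuity_2d_continuous_l P), differentiable_continuity_pt. now exists px, py.
Qed.

Lemma ex_RInt_vertical (P Q : R -> R -> R) (a0 b0 c0 d0 : R) a b c d :
  closed_form_on P Q a0 b0 c0 d0 ->
  c0 <= c -> c <= d -> d <= d0 -> a0 <= a <= b0 -> a0 <= b <= b0 ->
  ex_RInt (fun y => Q b y - Q a y) c d.
Proof.
  intros Hdiff **. apply ex_RInt_continuous_le; auto. intros y Hy.
  apply (continuous_minus (V := R_NormedModule)).
  - destruct (Hdiff b y) as (px & py & qx & qy & _ & H4 & _); try lra.
    apply (continuity_2d_continuous_r Q), differentiable_continuity_pt. now exists qx, qy.
  - destruct (Hdiff a y) as (px & py & qx & qy & _ & H4 & _); try lra.
    apply (continuity_2d_continuous_r Q), differentiable_continuity_pt. now exists qx, qy.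
Qed.

Lemma RInt_split_add (f g h k : R -> R) (a m b : R) :
  ex_RInt f a m -> ex_RInt g a m -> ex_RInt h m b -> ex_RInt k m b ->
  forall F : R -> R, (forall x, F x = f x + g x) -> (forall x, F x = h x + k x) ->
  RInt F a b = RInt f a m + RInt g a m + (RInt h m b + RInt k m b).
Proof.
  intros Hf Hg Hh Hk F E1 E2.
  assert (I1 : is_RInt F a m (plus (RInt f a m) (RInt g a m))).
  { apply (is_RInt_ext (V := R_NormedModule) (fun x => plus (f x) (g x))). intros; now rewrite E1.
    apply (is_RInt_plus (V := R_NormedModule)); now apply (RInt_correct (V := R_CompleteNormedModule)). }
  assert (I2 : is_RInt F m b (plus (RInt h m b) (RInt k m b))).
  { apply (is_RInt_ext (V := R_NormedModule) (fun x => plus (h x) (k x))). intros; now rewrite E2.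
    apply (is_RInt_plus (V := R_NormedModule)); now apply (RInt_correct (V := R_CompleteNormedModule)). }
  apply is_RInt_unique. exact (is_RInt_Chasles _ _ _ _ _ _ I1 I2).
Qed.

(** Inner sides are traversed twice, in opposite directions: [P x c - P x d] telescopes through the
    height [n], and [Q b y - Q a y] through the abscissa [m]. *)
Lemma rectangle_integral_quarters (P Q : R -> R -> R) (a0 b0 c0 d0 : R) a b c d :
  closed_form_on P Q a0 b0 c0 d0 ->
  a0 <= a -> a <= b -> b <= b0 -> c0 <= c -> c <= d -> d <= d0 ->
  let m := (a + b) / 2 in let n := (c + d) / 2 in
  rectangle_integral P Q a b c d =
    rectangle_integral P Q a m c n + rectangle_integral P Q m b c n +
    (rectangle_integral P Q a m n d + rectangle_integral P Q m b n d).
Proof.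
  intros Hdiff Ha Hab Hb Hc Hcd Hd m n. unfold rectangle_integral.
  assert (a <= m <= b) by (unfold m; lra). assert (c <= n <= d) by (unfold n; lra).
  rewrite (RInt_split_add (fun x => P x c - P x n) (fun x => P x n - P x d)
             (fun x => P x c - P x n) (fun x => P x n - P x d) a m b)
    by first [intros; ring | apply (ex_RInt_horizontal P Q a0 b0 c0 d0); [assumption|lra..]].
  rewrite (RInt_split_add (fun y => Q b y - Q m y) (fun y => Q m y - Q a y)
             (fun y => Q b y - Q m y) (fun y => Q m y - Q a y) c n d)
    by first [intros; ring | apply (ex_RInt_vertical P Q a0 b0 c0 d0); [assumption|lra..]].
  ring.
Qed.

(** With [D] half the perimeter, the bound [e * D ^ 2] passes from the quarters to the box, because
    four times [(D / 2) ^ 2] is [D ^ 2]. On small boxes the first-order parts of the form contribute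
    [qx - py] times the area, which vanishes, and differentiability alone controls the rest. *)
Lemma rectangle_integral_zero (P Q : R -> R -> R) (a0 b0 c0 d0 : R) :
  closed_form_on P Q a0 b0 c0 d0 -> a0 <= b0 -> c0 <= d0 -> rectangle_integral P Q a0 b0 c0 d0 = 0.
Proof.
  intros Hdiff Hab Hcd.
  assert (Hk : forall e, 0 < e ->
    Rabs (rectangle_integral P Q a0 b0 c0 d0) <= e * ((b0 - a0) + (d0 - c0)) ^ 2).
  { intros e He.
    apply (rectangle_bisection (fun a b c d =>
      Rabs (rectangle_integral P Q a b c d) <= e * ((b - a) + (d - c)) ^ 2)); auto.
    - intros a b c d ? ? ? ? ? ? H1 H2 H3 H4. rewrite (rectangle_integral_quarters P Q a0 b0 c0 d0) by assumption.
      eapply Rle_trans. apply Rabs_triang.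
      eapply Rle_trans. apply Rplus_le_compat; (eapply Rle_trans; [apply Rabs_triang|]);
        apply Rplus_le_compat; eassumption.
      right. field.
    - intros x y Hx Hy. destruct (Hdiff x y Hx Hy) as (px & py & qx & qy & HP & HQ & Epq).
      assert (He2 : 0 < e / 2) by lra.
      destruct (HP (mkposreal _ He2)) as [d1 H1]. destruct (HQ (mkposreal _ He2)) as [d2 H2].
      simpl in H1, H2. pose proof (cond_pos d1). pose proof (cond_pos d2).
      exists (Rmin d1 d2). split. now apply Rmin_pos.
      intros a b c d Ha Hb Hc Hd Hxab Hycd Hw Hh.
      pose proof (Rmin_l d1 d2). pose proof (Rmin_r d1 d2).
      set (D := (b - a) + (d - c)).
      assert (HD : 0 <= D) by (unfold D; lra).
      assert (HM : forall u v, a <= u <= b -> c <= v <= d -> Rmax (Rabs (u - x)) (Rabs (v - y)) <= D).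
      { intros u v Hu Hv. unfold D. apply Rmax_lub; apply Rabs_le; lra. }
      assert (B1 : forall u v, a <= u <= b -> c <= v <= d ->
        Rabs (P u v - P x y - (px * (u - x) + py * (v - y))) <= e / 2 * D).
      { intros u v Hu Hv. eapply Rle_trans. apply H1; apply Rabs_def1; lra.
        apply Rmult_le_compat_l. lra. now apply HM. }
      assert (B2 : forall u v, a <= u <= b -> c <= v <= d ->
        Rabs (Q u v - Q x y - (qx * (u - x) + qy * (v - y))) <= e / 2 * D).
      { intros u v Hu Hv. eapply Rle_trans. apply H2; apply Rabs_def1; lra.
        apply Rmult_le_compat_l. lra. now apply HM. }
      (* In [P u c - P u d] the value at [(x, y)] and the [px] terms cancel. What remains is the
         constant [py * (c - d)] and two errors of size [e / 2 * D]. *)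
      assert (I1 : Rabs (RInt (fun x => P x c - P x d) a b - (py * (c - d)) * (b - a)) <= (b - a) * (e * D)).
      { apply RInt_near_const. lra. apply (ex_RInt_horizontal P Q a0 b0 c0 d0); [assumption|lra..].
        intros u Hu. assert (C1 := B1 u c Hu ltac:(lra)). assert (C2 := B1 u d Hu ltac:(lra)).
        apply Rabs_le_between in C1. apply Rabs_le_between in C2. apply Rabs_le. split; lra. }
      assert (I2 : Rabs (RInt (fun y => Q b y - Q a y) c d - (qx * (b - a)) * (d - c)) <= (d - c) * (e * D)).
      { apply RInt_near_const. lra. apply (ex_RInt_vertical P Q a0 b0 c0 d0); [assumption|lra..].
        intros v Hv. assert (C1 := B2 b v ltac:(lra) Hv). assert (C2 := B2 a v ltac:(lra) Hv).
        apply Rabs_le_between in C1. apply Rabs_le_between in C2. apply Rabs_le. split; lra. }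
      subst py. unfold rectangle_integral.
      replace (_ + _) with ((RInt (fun x0 => P x0 c - P x0 d) a b - qx * (c - d) * (b - a)) +
        (RInt (fun y0 => Q b y0 - Q a y0) c d - qx * (b - a) * (d - c))) by ring.
      eapply Rle_trans. apply Rabs_triang.
      eapply Rle_trans. apply Rplus_le_compat; eassumption.
      right. unfold D. ring. }
  set (I := rectangle_integral P Q a0 b0 c0 d0) in *.
  set (S := ((b0 - a0) + (d0 - c0)) ^ 2) in *.
  assert (HS : 0 <= S) by apply pow2_ge_0.
  destruct (Req_dec I 0) as [|HI]; [assumption|exfalso].
  apply Rabs_pos_lt in HI.
  (* This value of [e] gives [|I| <= |I| * S / (2 * (S + 1))], impossible for nonzero [I]; the [+ 1]
     keeps the denominator positive for a degenerate box. *)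
  specialize (Hk (Rabs I / (2 * (S + 1)))).
  assert (Hpos : 0 < Rabs I / (2 * (S + 1))) by (apply Rdiv_lt_0_compat; lra).
  specialize (Hk Hpos).
  apply Rmult_le_compat_r with (r := 2 * (S + 1)) in Hk. 2: lra.
  replace (Rabs I / (2 * (S + 1)) * S * (2 * (S + 1))) with (Rabs I * S) in Hk by (field; lra).
  nra.
Qed.

(** * Mean values over circles *)

Definition cis (r t : R) : C := (r * cos t, r * sin t).

Lemma Cmod_cis (r t : R) : 0 <= r -> Cmod (cis r t) = r.
Proof.
  intros Hr. unfold Cmod, cis; simpl. rewrite <- (sqrt_square r) at 5 by assumption.
  apply f_equal. pose proof (sin2_cos2 t) as H. unfold Rsqr in H.
  transitivity (r * r * (sin t * sin t + cos t * cos t)); [ring|rewrite H; ring].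
Qed.

Lemma cis_2PI (r : R) : cis r (2 * PI) = cis r 0.
Proof. unfold cis. now rewrite cos_2PI, sin_2PI, cos_0, sin_0. Qed.

Lemma differentiable_pt_lim_id1 (x y : R) : differentiable_pt_lim (fun u _ => u) x y 1 0.
Proof.
  intros eps. exists eps. intros u v _ _.
  replace (u - x - _) with 0 by ring. rewrite Rabs_R0.
  apply Rmult_le_pos. apply Rlt_le, cond_pos.
  apply Rle_trans with (2 := Rmax_l _ _), Rabs_pos.
Qed.

Lemma differentiable_pt_lim_id2 (x y : R) : differentiable_pt_lim (fun _ v => v) x y 0 1.
Proof.
  intros eps. exists eps. intros u v _ _.
  replace (v - y - _) with 0 by ring. rewrite Rabs_R0.
  apply Rmult_le_pos. apply Rlt_le, cond_pos.
  apply Rle_trans with (2 := Rmax_l _ _), Rabs_pos.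
Qed.

Lemma differentiable_pt_lim_product (x y : R) : differentiable_pt_lim (fun u v => u * v) x y y x.
Proof.
  intros eps. exists eps. intros u v Hu Hv.
  replace (u * v - x * y - _) with ((u - x) * (v - y)) by ring.
  rewrite Rabs_mult. apply Rmult_le_compat; try apply Rabs_pos. lra. apply Rmax_r.
Qed.

Lemma differentiable_pt_lim_separated (f g : R -> R) (x y df dg : R) :
  derivable_pt_lim f x df -> derivable_pt_lim g y dg ->
  differentiable_pt_lim (fun u v => f u * g v) x y (df * g y) (f x * dg).
Proof.
  intros Hf Hg.
  assert (Hg2 : differentiable_pt_lim (fun _ v => g v) x y 0 dg).
  { pose proof (differentiable_pt_lim_comp (fun a _ => g a) (fun _ v => v) (fun u _ => u) x y _ _ _ _ _ _
      (differentiable_pt_lim_proj1_0 g y x dg Hg) (differentiable_pt_lim_id2 x y) (differentiable_pt_lim_id1 x y)) as H.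
    simpl in H. replace (dg * 0 + 0 * 1) with 0 in H by ring. replace (dg * 1 + 0 * 0) with dg in H by ring. exact H. }
  pose proof (differentiable_pt_lim_comp _ _ _ x y _ _ _ _ _ _ (differentiable_pt_lim_product (f x) (g y))
    (differentiable_pt_lim_proj1_0 f x y df Hf) Hg2) as H.
  replace (df * g y) with (g y * df + f x * 0) by ring.
  replace (f x * dg) with (g y * 0 + f x * dg) by ring. exact H.
Qed.

(** [cis (exp s) t] is the exponential of [zeta = s + i t], so [v ds + u dt] is the imaginary part
    of [g (exp zeta) d zeta]. The equation [py = qx] is one of the Cauchy-Riemann equations for [g]
    composed with the exponential. *)
Lemma log_polar_closed (g : C -> C) (s t : R) (l : C) :
  cdiff g (cis (exp s) t) l ->
  exists px py qx qy,
    differentiable_pt_lim (fun s t => Im (g (cis (exp s) t))) s t px py /\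
    differentiable_pt_lim (fun s t => Re (g (cis (exp s) t))) s t qx qy /\ py = qx.
Proof.
  intros H.
  assert (HX := differentiable_pt_lim_separated exp cos s t _ _ (derivable_pt_lim_exp s) (derivable_pt_lim_cos t)).
  assert (HY := differentiable_pt_lim_separated exp sin s t _ _ (derivable_pt_lim_exp s) (derivable_pt_lim_sin t)).
  assert (Hu := differentiable_pt_lim_comp (re_part g) _ _ s t _ _ _ _ _ _
    (cdiff_differentiable_re g _ _ l H) HX HY).
  assert (Hv := differentiable_pt_lim_comp (im_part g) _ _ s t _ _ _ _ _ _
    (cdiff_differentiable_im g _ _ l H) HX HY).
  do 4 eexists. split; [exact Hv|split; [exact Hu|]]. ring.
Qed.


Lemma continuous_circle_re (g : C -> C) (r t : R) (l : C) : 0 < r ->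
  cdiff g (cis r t) l -> continuous (fun t => Re (g (cis r t))) t.
Proof.
  intros Hr H. rewrite <- (exp_ln r Hr) in *.
  destruct (log_polar_closed g (ln r) t l H) as (px & py & qx & qy & _ & H2 & _).
  apply (continuity_2d_continuous_r (fun s t => Re (g (cis (exp s) t)))).
  apply differentiable_continuity_pt. now exists qx, qy.
Qed.

Lemma ex_RInt_circle_re (g : C -> C) (r : R) : 0 < r ->
  (forall t, exists l, cdiff g (cis r t) l) ->
  ex_RInt (fun t => Re (g (cis r t))) 0 (2 * PI).
Proof.
  intros Hr H. pose proof PI_RGT_0. apply ex_RInt_continuous_le. lra.
  intros t _. destruct (H t) as [l Hl]. exact (continuous_circle_re g r t l Hr Hl).
Qed.

(** The annulus is the image of the rectangle with [s] from [ln r1] to [ln r2] and [t] from [0] to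
    [2 * PI]. Its sides [t = 0] and [t = 2 * PI] carry the same values and cancel; the other two
    sides are the circles. The origin is never visited. *)
Lemma circle_mean_radius (g : C -> C) (R0 r1 r2 : R) :
  (forall z, 0 < Cmod z < R0 -> exists l, cdiff g z l) ->
  0 < r1 -> r1 <= r2 -> r2 < R0 ->
  RInt (fun t => Re (g (cis r1 t))) 0 (2 * PI) = RInt (fun t => Re (g (cis r2 t))) 0 (2 * PI).
Proof.
  intros Hg H1 H12 H2. pose proof PI_RGT_0 as HPI.
  assert (Hd : forall r t, 0 < r < R0 -> exists l, cdiff g (cis r t) l).
  { intros r t Hr. apply Hg. rewrite Cmod_cis; lra. }
  assert (Hz := rectangle_integral_zero (fun s t => Im (g (cis (exp s) t)))
    (fun s t => Re (g (cis (exp s) t))) (ln r1) (ln r2) 0 (2 * PI)).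
  unfold rectangle_integral in Hz.
  rewrite (RInt_ext (V := R_CompleteNormedModule) (fun x => Im (g (cis (exp x) 0)) - Im (g (cis (exp x) (2 * PI)))) (fun _ => 0)) in Hz.
  2: { intros x _. rewrite cis_2PI. apply Rminus_diag. }
  rewrite RInt_const, !exp_ln in Hz by lra.
  rewrite (RInt_minus (fun t => Re (g (cis r2 t))) (fun t => Re (g (cis r1 t)))) in Hz.
  2, 3: apply ex_RInt_circle_re; [lra|intros; apply Hd; lra].
  unfold scal, minus, plus, opp in Hz; simpl in Hz; unfold mult in Hz; simpl in Hz.
  cut ((ln r2 - ln r1) * 0 +
     (RInt (fun t : R => Re (g (cis r2 t))) 0 (2 * PI) +
      - RInt (fun t : R => Re (g (cis r1 t))) 0 (2 * PI)) = 0). lra.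
  apply Hz. 2: { apply ln_le; lra. } 2: lra.
  intros s t Hs _.
  destruct (Hd (exp s) t) as [l Hl]. split. apply exp_pos.
  apply Rle_lt_trans with (2 := H2). rewrite <- (exp_ln r2) by lra.
  destruct (Rle_lt_or_eq_dec s (ln r2)) as [Hlt| ->]. lra.
  now apply Rlt_le, exp_increasing. lra.
  exact (log_polar_closed g s t l Hl).
Qed.

Lemma circle_mean (g : C -> C) (R0 r : R) :
  (forall z, 0 < Cmod z < R0 -> exists l, cdiff g z l) -> ccont g 0 -> 0 < r < R0 ->
  RInt (fun t => Re (g (cis r t))) 0 (2 * PI) = 2 * PI * Re (g 0).
Proof.
  intros Hg H0 Hr. pose proof PI_RGT_0 as HPI.
  set (I := RInt _ _ _).
  assert (Hk : forall e, 0 < e -> Rabs (I - Re (g 0) * (2 * PI - 0)) <= (2 * PI - 0) * e).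
  { intros e He. destruct (H0 e He) as [d [Hd H]].
    (* The circle is shrunk into the neighbourhood of [0] on which [g] stays within [e] of [g 0];
       that neighbourhood is open, hence [d / 2]. *)
    set (r1 := Rmin r (d / 2)).
    assert (Hr1 : 0 < r1) by (apply Rmin_pos; lra).
    assert (r1 <= r) by apply Rmin_l. assert (r1 <= d / 2) by apply Rmin_r.
    unfold I. rewrite <- (circle_mean_radius g R0 r1 r) by (assumption || lra).
    apply RInt_near_const. lra.
    apply ex_RInt_circle_re. lra. intros t. apply Hg. rewrite Cmod_cis; lra.
    intros t _. specialize (H (cis r1 t)).
    replace (Re _ - Re _) with (Re (g (cis r1 t) - g 0)%C) by (unfold Re; simpl; ring).
    eapply Rle_trans. apply re_le_Cmod. apply Rlt_le, H.
    replace (cis r1 t - 0)%C with (cis r1 t) by ring. rewrite Cmod_cis; lra. }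
  destruct (Req_dec I (2 * PI * Re (g 0))) as [|HI]; [assumption|exfalso].
  set (X := I - Re (g 0) * (2 * PI - 0)) in *.
  assert (HX : 0 < Rabs X) by (apply Rabs_pos_lt; unfold X; lra).
  specialize (Hk (Rabs X / (4 * PI))).
  assert (He : 0 < Rabs X / (4 * PI)) by (apply Rdiv_lt_0_compat; lra).
  specialize (Hk He). replace ((2 * PI - 0) * (Rabs X / (4 * PI))) with (Rabs X / 2) in Hk by (field; lra).
  lra.
Qed.

Lemma circle_mean_le (g : C -> C) (R0 r M : R) :
  (forall z, 0 < Cmod z < R0 -> exists l, cdiff g z l) -> ccont g 0 -> 0 < r < R0 ->
  (forall t, 0 <= t <= 2 * PI -> Re (g (cis r t)) <= M) -> Re (g 0) <= M.
Proof.
  intros Hg H0 Hr HM. pose proof PI_RGT_0 as HPI.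
  apply Rmult_le_reg_l with (2 * PI). lra.
  rewrite <- (circle_mean g R0 r) by assumption.
  replace (2 * PI * M) with (RInt (fun _ => M) 0 (2 * PI)).
  2: { rewrite RInt_const. unfold scal; simpl; unfold mult; simpl. ring. }
  apply RInt_le. lra. 2: apply ex_RInt_const.
  apply ex_RInt_circle_re. lra. intros t. apply Hg. rewrite Cmod_cis; lra.
  intros t Ht. apply HM. lra.
Qed.

(** The equality case: a strict deficit at one angle persists on an arc by continuity and pushes the
    mean below [M]. An angle strictly between [0] and [2 * PI] leaves room for an arc on both
    sides. *)
Lemma circle_mean_eq (g : C -> C) (R0 r M : R) :
  (forall z, 0 < Cmod z < R0 -> exists l, cdiff g z l) -> ccont g 0 -> 0 < r < R0 ->
  (forall t, Re (g (cis r t)) <= M) -> Re (g 0) = M ->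
  forall t, 0 < t < 2 * PI -> Re (g (cis r t)) = M.
Proof.
  intros Hg H0 Hr HM HE t Ht. pose proof PI_RGT_0 as HPI.
  destruct (Rle_lt_or_eq_dec _ _ (HM t)) as [Hlt|]; [exfalso|assumption].
  set (h := fun t => Re (g (cis r t))) in *.
  assert (Hd : forall t, exists l, cdiff g (cis r t) l). { intros. apply Hg. rewrite Cmod_cis; lra. }
  assert (Hc : forall t, continuous h t).
  { intros x. destruct (Hd x) as [l Hl]. apply (continuous_circle_re g r x l); [lra|assumption]. }
  assert (Hmean : RInt h 0 (2 * PI) = 2 * PI * M) by (rewrite <- HE; now apply (circle_mean g R0 r)).
  change (h t < M) in Hlt. set (e := (M - h t) / 2). assert (He : 0 < e) by (unfold e; lra).
  destruct (Hc t (fun y => Rabs (y - h t) < e)) as [d Hdd].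
  { exists (mkposreal e He). intros y Hy. exact Hy. }
  (* Halving each distance keeps [[t - k, t + k]] inside both the continuity neighbourhood and the
     interval of integration. *)
  set (k := Rmin (d / 2) (Rmin (t / 2) ((2 * PI - t) / 2))).
  pose proof (cond_pos d).
  assert (Hk : 0 < k) by (repeat apply Rmin_pos; lra).
  assert (Hk1 : k <= d / 2) by apply Rmin_l.
  assert (Hk2 : k <= t / 2) by (eapply Rle_trans; [apply Rmin_r|apply Rmin_l]).
  assert (Hk3 : k <= (2 * PI - t) / 2) by (eapply Rle_trans; [apply Rmin_r|apply Rmin_r]).
  assert (Hex : forall a b, a <= b -> ex_RInt h a b) by (intros; apply ex_RInt_continuous_le; auto).
  assert (HleM : forall a b N, a <= b -> (forall x, a < x < b -> h x <= N) -> RInt h a b <= (b - a) * N).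
  { intros a b N Hab HN. replace ((b - a) * N) with (RInt (fun _ => N) a b).
    2: { rewrite RInt_const. reflexivity. }
    apply RInt_le; auto. apply ex_RInt_const. }
  assert (E : RInt h 0 (2 * PI) = RInt h 0 (t - k) + (RInt h (t - k) (t + k) + RInt h (t + k) (2 * PI))).
  { rewrite <- (RInt_Chasles h 0 (t - k) (2 * PI)) by (apply Hex; lra).
    rewrite <- (RInt_Chasles h (t - k) (t + k) (2 * PI)) by (apply Hex; lra). reflexivity. }
  assert (L1 := HleM 0 (t - k) M ltac:(lra) (fun x _ => HM x)).
  assert (L3 := HleM (t + k) (2 * PI) M ltac:(lra) (fun x _ => HM x)).
  assert (L2 : RInt h (t - k) (t + k) <= (t + k - (t - k)) * (M - e)).
  { apply HleM. lra. intros x Hx.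
    assert (Hb : Rabs (h x - h t) < e).
    { apply Hdd. unfold ball; simpl; unfold AbsRing_ball, abs, minus, plus, opp; simpl.
      apply Rabs_def1; lra. }
    apply Rabs_def2 in Hb. unfold e in *. lra. }
  nra.
Qed.

(** * Difference quotients and the Cauchy estimate at the origin *)

Lemma cdiff_self f z l : cdiff f z l -> cdiff f z (C_derive f z).
Proof. intros H. now rewrite (cdiff_C_derive _ _ _ H). Qed.

Lemma cdiff_scal (c : C) f z l : cdiff f z l -> cdiff (fun w => c * f w)%C z (c * l).
Proof.
  intros H. replace (c * l)%C with (0 * f z + c * l)%C by ring.
  apply (cdiff_mult (fun _ => c)). apply cdiff_const. exact H.
Qed.

Lemma ccont_scal (c : C) f z : ccont f z -> ccont (fun w => c * f w)%C z.
Proof.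
  intros H e He. pose proof (Cmod_ge_0 c).
  destruct (H (e / (Cmod c + 1))) as [d [Hd H']]. apply Rdiv_lt_0_compat; lra.
  exists d. split; auto. intros w Hw. specialize (H' w Hw).
  replace (c * f w - c * f z)%C with (c * (f w - f z))%C by ring. rewrite Cmod_mult.
  pose proof (Cmod_ge_0 (f w - f z)).
  apply Rmult_lt_compat_r with (r := Cmod c + 1) in H'. 2: lra.
  unfold Rdiv in H'. rewrite Rmult_assoc, Rinv_l in H' by lra. nra.
Qed.

(** The difference quotient at the origin with its singularity filled by [l]. When [l] is the
    derivative at [0], it is continuous at [0], and it is differentiable wherever else [f] is:
    exactly the input that [circle_mean] accepts. *)
Definition dquot (f : C -> C) (l : C) (z : C) : C :=
  if Ceq_dec z 0 then l else ((f z - f 0) / z)%C.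

Lemma dquot_0 f l : dquot f l 0 = l.
Proof. unfold dquot. destruct Ceq_dec; congruence. Qed.

Lemma dquot_neq f l (z : C) : z <> 0 -> dquot f l z = ((f z - f 0) / z)%C.
Proof. intros H. unfold dquot. destruct Ceq_dec; congruence. Qed.

Lemma dquot_cdiff f l (z m : C) : z <> 0 -> cdiff f z m -> exists n, cdiff (dquot f l) z n.
Proof.
  intros Hz H. eexists. apply (cdiff_ext_loc (fun w => (f w - f 0) * / w)%C).
  - exists (Cmod z). split. now apply Cmod_gt_0.
    intros w Hw. rewrite dquot_neq. reflexivity. intros ->.
    rewrite Cmod_minus_sym in Hw. replace (z - 0)%C with z in Hw by ring. lra.
  - apply cdiff_mult. apply cdiff_minus. exact H. apply cdiff_const. now apply cdiff_inv.
Qed.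

Lemma dquot_ccont f l : cdiff f 0 l -> ccont (dquot f l) 0.
Proof.
  intros H e He. destruct (H (e / 2)) as [d [Hd H']]. lra.
  exists d. split; auto. intros w Hw. rewrite dquot_0. unfold dquot. destruct Ceq_dec as [->|Hw0].
  - replace (l - l)%C with (RtoC 0) by ring. now rewrite Cmod_0.
  - specialize (H' w Hw). replace (w - 0)%C with w in H' by ring.
    replace ((f w - f 0) / w - l)%C with ((f w - f 0 - l * w) / w)%C by (field; auto).
    rewrite Cmod_div by auto. assert (Hm := proj1 (Cmod_gt_0 w) Hw0).
    apply Rmult_lt_reg_r with (Cmod w). lra. unfold Rdiv. rewrite Rmult_assoc, Rinv_l by lra. nra.
Qed.

Lemma Re_conj_mult (l : C) : Re (Cconj l * l) = Cmod l ^ 2.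
Proof. rewrite Cmod2_alt. unfold Re, Im, Cconj; simpl. ring. Qed.

(** Multiplying the difference quotient by [Cconj l] makes its central value the real number
    [|l| ^ 2], so the mean value bound for real parts gives [|l| ^ 2 <= |l| * (M / r)]. *)
Lemma cauchy_estimate (f : C -> C) (R0 r M : R) (l : C) :
  (forall z, Cmod z < R0 -> exists m, cdiff f z m) -> cdiff f 0 l -> 0 < r < R0 ->
  (forall z, Cmod z = r -> Cmod (f z - f 0) <= M) -> Cmod l <= M / r.
Proof.
  intros Hf H0 Hr HM.
  assert (Hg := circle_mean_le (fun z => Cconj l * dquot f l z)%C R0 r (Cmod l * (M / r))).
  cbv beta in Hg. rewrite dquot_0, Re_conj_mult in Hg.
  assert (Hm : Cmod l ^ 2 <= Cmod l * (M / r)).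
  { apply Hg; auto.
    - intros z Hz. assert (Hz0 : z <> 0) by (apply Cmod_gt_0; lra).
      destruct (Hf z) as [m Hm]. lra. destruct (dquot_cdiff f l z m Hz0 Hm) as [n Hn].
      eexists. apply cdiff_scal, Hn.
    - apply ccont_scal, dquot_ccont, H0.
    - intros t _. eapply Rle_trans. apply Rle_abs. eapply Rle_trans. apply re_le_Cmod.
      rewrite Cmod_mult, Cmod_conj. apply Rmult_le_compat_l. apply Cmod_ge_0.
      assert (Hc : Cmod (cis r t) = r) by (apply Cmod_cis; lra).
      assert (Hc0 : cis r t <> 0) by (apply Cmod_gt_0; lra).
      rewrite dquot_neq, Cmod_div, Hc by auto.
      apply Rmult_le_compat_r. apply Rlt_le, Rinv_0_lt_compat; lra. now apply HM. }
  (* Covers [l = 0], where a factor [|l|] cannot be cancelled. *)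
  assert (HM0 : 0 <= M / r).
  { apply Rmult_le_pos. eapply Rle_trans. 2: apply (HM (cis r 0)); apply Cmod_cis; lra. apply Cmod_ge_0.
    apply Rlt_le, Rinv_0_lt_compat; lra. }
  pose proof (Cmod_ge_0 l). nra.
Qed.

(** * The Schwarz-Pick lemma *)

(** The involution [L_a] of the overview. With this sign it exchanges [0] and [a] and is its own
    inverse. *)
Definition mob (a z : C) : C := ((a - z) / (1 - Cconj a * z))%C.

Lemma Cmod_sq_lt_1 (z : C) : Cmod z < 1 -> Cmod z ^ 2 < 1.
Proof. intros. pose proof (Cmod_ge_0 z). nra. Qed.

Lemma mob_den (a z : C) : Cmod a < 1 -> Cmod z < 1 -> (1 - Cconj a * z)%C <> 0.
Proof.
  intros Ha Hz. apply Cmod_gt_0. pose proof (Cmod_triangle_rev 1 (Cconj a * z)) as H.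
  rewrite Cmod_1, Cmod_mult, Cmod_conj in H.
  pose proof (Cmod_ge_0 a). pose proof (Cmod_ge_0 z). nra.
Qed.

Lemma mob_den_identity (a z : C) :
  Cmod (1 - Cconj a * z) ^ 2 - Cmod (a - z) ^ 2 = (1 - Cmod a ^ 2) * (1 - Cmod z ^ 2).
Proof. rewrite !Cmod2_alt. unfold Re, Im, Cconj; simpl. ring. Qed.

Lemma mob_identity (a z : C) : Cmod a < 1 -> Cmod z < 1 ->
  1 - Cmod (mob a z) ^ 2 = (1 - Cmod a ^ 2) * (1 - Cmod z ^ 2) / Cmod (1 - Cconj a * z) ^ 2.
Proof.
  intros Ha Hz. assert (Hd := mob_den a z Ha Hz). assert (Hm := proj1 (Cmod_gt_0 _) Hd).
  unfold mob. rewrite Cmod_div by assumption. rewrite <- mob_den_identity. field. lra.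
Qed.

Lemma mob_disc (a z : C) : Cmod a < 1 -> Cmod z < 1 -> Cmod (mob a z) < 1.
Proof.
  intros Ha Hz. assert (Hm := proj1 (Cmod_gt_0 _) (mob_den a z Ha Hz)).
  assert (H := mob_identity a z Ha Hz).
  pose proof (Cmod_sq_lt_1 a Ha). pose proof (Cmod_sq_lt_1 z Hz).
  assert (0 < 1 - Cmod (mob a z) ^ 2).
  { rewrite H. apply Rdiv_lt_0_compat. nra. now apply pow_lt. }
  pose proof (Cmod_ge_0 (mob a z)). nra.
Qed.

Lemma mob_involutive (a z : C) : Cmod a < 1 -> Cmod z < 1 -> mob a (mob a z) = z.
Proof.
  intros Ha Hz. assert (Hd := mob_den a z Ha Hz).
  assert (Hd2 := mob_den a (mob a z) Ha (mob_disc a z Ha Hz)).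
  assert (Hd3 := mob_den a a Ha Ha).
  unfold mob in *. field. split; auto.
  intros E. apply Hd3. rewrite <- E. ring.
Qed.

Lemma mob_0 (a : C) : mob a 0 = a.
Proof. unfold mob. replace (1 - Cconj a * 0)%C with (RtoC 1) by ring. field. Qed.

Lemma mob_self (a : C) : mob a a = 0.
Proof. unfold mob. replace (a - a)%C with (RtoC 0) by ring. unfold Cdiv. ring. Qed.

Definition mob_deriv (a z : C) : C := ((Cconj a * a - 1) / ((1 - Cconj a * z) * (1 - Cconj a * z)))%C.

Lemma cdiff_eq f g z l m : (forall w, f w = g w) -> l = m -> cdiff f z l -> cdiff g z m.
Proof.
  intros E -> H. apply (cdiff_ext_loc f g). exists 1. split. lra. intros; apply E. exact H.
Qed.

Lemma cdiff_affine (p q z : C) : cdiff (fun w => p + q * w)%C z q.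
Proof.
  refine (cdiff_eq _ _ _ _ _ (fun _ => eq_refl) _
    (cdiff_plus _ _ _ _ _ (cdiff_const p z) (cdiff_scal q _ _ _ (cdiff_id z)))).
  ring.
Qed.

Lemma cdiff_mob (a z : C) : Cmod a < 1 -> Cmod z < 1 -> cdiff (mob a) z (mob_deriv a z).
Proof.
  intros Ha Hz. assert (Hd := mob_den a z Ha Hz).
  assert (H1 := cdiff_affine a (-1) z). assert (H2 := cdiff_affine 1 (- Cconj a) z).
  assert (Hd' : (1 + - Cconj a * z)%C <> 0) by (intros E; apply Hd; rewrite <- E; ring).
  assert (H3 := cdiff_comp Cinv _ z _ _ (cdiff_inv _ Hd') H2).
  refine (cdiff_eq _ _ _ _ _ _ _ (cdiff_mult _ _ _ _ _ H1 H3)).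
  - intros w. unfold mob, Cdiv. f_equal. ring. f_equal. ring.
  - unfold mob_deriv. field; repeat split; assumption.
Qed.

Lemma Cmod_mob_deriv (a z : C) : Cmod a < 1 -> Cmod z < 1 ->
  Cmod (mob_deriv a z) = (1 - Cmod a ^ 2) / Cmod (1 - Cconj a * z) ^ 2.
Proof.
  intros Ha Hz. assert (Hd := mob_den a z Ha Hz). unfold mob_deriv.
  rewrite Cmod_div by (apply Cmult_neq_0; assumption). rewrite Cmod_mult.
  replace (Cconj a * a - 1)%C with (RtoC (- (1 - Cmod a ^ 2))).
  - rewrite Cmod_R, Rabs_Ropp, Rabs_pos_eq. assert (Hm := proj1 (Cmod_gt_0 _) Hd). field. lra.
    pose proof (Cmod_sq_lt_1 a Ha). lra.
  - rewrite RtoC_opp, RtoC_minus, Cmod2_conj. ring.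
Qed.

Definition holomorphic_self_map (phi : C -> C) : Prop :=
  (forall z, Cmod z < 1 -> Cmod (phi z) < 1) /\
  (forall z, Cmod z < 1 -> cdiff phi z (C_derive phi z)).

Lemma holomorphic_self_map_mob a : Cmod a < 1 -> holomorphic_self_map (mob a).
Proof.
  intros Ha. split; intros z Hz. now apply mob_disc.
  eapply cdiff_self. now apply cdiff_mob.
Qed.

Lemma holomorphic_self_map_comp phi psi : holomorphic_self_map phi -> holomorphic_self_map psi ->
  holomorphic_self_map (fun z => phi (psi z)).
Proof.
  intros [H1 H2] [H3 H4]. split; intros z Hz. auto.
  eapply cdiff_self. apply cdiff_comp. apply H2, H3, Hz. apply H4, Hz.
Qed.

(** Moves both [a] and [phi a] to the origin, where the mean value tools apply. *)
Definition recentred (phi : C -> C) (a w : C) : C := mob (phi a) (phi (mob a w)).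

Lemma recentred_holo phi a : holomorphic_self_map phi -> Cmod a < 1 -> holomorphic_self_map (recentred phi a).
Proof.
  intros H Ha. unfold recentred.
  apply (holomorphic_self_map_comp (mob (phi a)) (fun w => phi (mob a w))).
  apply holomorphic_self_map_mob. now apply H.
  apply (holomorphic_self_map_comp phi (mob a)). exact H. now apply holomorphic_self_map_mob.
Qed.

Lemma recentred_0 phi a : recentred phi a 0 = 0.
Proof. unfold recentred. rewrite mob_0. apply mob_self. Qed.

Lemma Cmod_lt_1_0 : Cmod 0 < 1.
Proof. rewrite Cmod_0. lra. Qed.

(** The outer factors of the chain rule are [1 - |a| ^ 2], from [mob a] at [0], and
    [1 / (1 - |b| ^ 2)], from [mob b] at [b = phi a]; with [|phi'(a)|] between them they make up
    [tau]. *)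
Lemma recentred_derive phi a : holomorphic_self_map phi -> Cmod a < 1 ->
  Cmod (C_derive (recentred phi a) 0) = tau phi a.
Proof.
  intros H Ha. assert (Hp : Cmod (phi a) < 1) by now apply H.
  assert (H1 := cdiff_mob a 0 Ha Cmod_lt_1_0).
  assert (H2 := proj2 H a Ha). rewrite <- (mob_0 a) in H2 at 1.
  assert (H3 := cdiff_mob (phi a) (phi a) Hp Hp). rewrite <- (mob_0 a) in H3 at 2.
  assert (H4 := cdiff_comp phi (mob a) 0 _ _ H2 H1).
  assert (H5 := cdiff_comp (mob (phi a)) (fun w => phi (mob a w)) 0 _ _ H3 H4).
  unfold recentred. rewrite (cdiff_C_derive _ _ _ H5).
  rewrite !Cmod_mult, !Cmod_mob_deriv by (assumption || apply Cmod_lt_1_0).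
  replace (1 - Cconj a * 0)%C with (RtoC 1) by ring. rewrite Cmod_1.
  replace (1 - Cconj (phi a) * phi a)%C with (RtoC (1 - Cmod (phi a) ^ 2)).
  2: { rewrite RtoC_minus, Cmod2_conj. ring. }
  pose proof (Cmod_sq_lt_1 _ Hp).
  rewrite Cmod_R, Rabs_pos_eq by lra. unfold tau. field. lra.
Qed.

Lemma schwarz_derive psi : holomorphic_self_map psi -> psi 0 = 0 -> Cmod (C_derive psi 0) <= 1.
Proof.
  intros [H1 H2] H0. apply Rnot_lt_le. intros Hlt.
  set (k := Cmod (C_derive psi 0)) in *.
  assert (Hk : 0 < / k < 1). { split. apply Rinv_0_lt_compat; lra. rewrite <- Rinv_1. apply Rinv_lt_contravar; lra. }
  (* Any radius strictly between [/ k] and [1] will do: the Cauchy estimate gives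
     [k <= 1 / r < k]. *)
  set (r := (1 + / k) / 2). assert (Hr : / k < r < 1) by (unfold r; lra).
  assert (Hc : k <= 1 / r).
  { apply (cauchy_estimate psi 1). intros z Hz; eexists; apply H2, Hz. apply H2, Cmod_lt_1_0. lra.
    intros z Hz. rewrite H0. replace (psi z - 0)%C with (psi z) by ring. apply Rlt_le, H1. lra. }
  assert (k * / k = 1) by (apply Rinv_r; lra).
  apply Rmult_le_compat_r with (r := r) in Hc. 2: lra.
  unfold Rdiv in Hc. rewrite Rmult_assoc, Rinv_l in Hc by lra. nra.
Qed.

Lemma schwarz_pick phi z : holomorphic_self_map phi -> Cmod z < 1 -> tau phi z <= 1.
Proof.
  intros H Hz. rewrite <- recentred_derive by assumption.
  apply schwarz_derive. now apply recentred_holo. apply recentred_0.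
Qed.

(** * The Schwarz lemma and its equality case *)

(** The modulus need not be differentiable, so estimates along a segment follow the real part of
    [c * f]. A unimodular [c] from [exists_direction] makes that real part equal to the modulus
    where it matters. *)
Lemma is_derive_along_line (f : C -> C) (c z0 e l : C) (t : R) :
  cdiff f (z0 + t * e)%C l ->
  is_derive (fun s : R => Re (c * f (z0 + s * e)%C)) t (Re (c * l * e)).
Proof.
  intros H. apply (cdiff_scal c) in H.
  set (X := fun s : R => Re z0 + s * Re e). set (Y := fun s : R => Im z0 + s * Im e).
  assert (E : forall s : R, (z0 + s * e)%C = (X s, Y s)).
  { intros s. unfold X, Y. destruct z0, e. unfold Cplus, Cmult, RtoC, Re, Im; simpl. f_equal; ring. }
  rewrite E in H. apply cdiff_differentiable_re in H.
  assert (HX : derivable_pt_lim X t (Re e)). { apply is_derive_Reals. unfold X. auto_derive; auto; ring. }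
  assert (HY : derivable_pt_lim Y t (Im e)). { apply is_derive_Reals. unfold Y. auto_derive; auto; ring. }
  assert (HD := derivable_pt_lim_comp_2d _ X Y t _ _ _ _ H HX HY).
  apply is_derive_Reals in HD.
  apply (is_derive_ext (fun s => re_part (fun w => c * f w)%C (X s) (Y s))).
  - intros s. rewrite E. reflexivity.
  - replace (Re (c * l * e)) with (Re (c * l) * Re e + - Im (c * l) * Im e). exact HD.
    rewrite (re_mult (c * l) e). ring.
Qed.

Lemma Re_le_Cmod (c : C) : Re c <= Cmod c.
Proof. eapply Rle_trans. apply Rle_abs. apply re_le_Cmod. Qed.

Lemma exists_direction (z : C) : exists u : C, Cmod u = 1 /\ Re (Cconj u * z) = Cmod z /\ z = (Cmod z * u)%C.
Proof.
  destruct (Ceq_dec z 0) as [->|Hz].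
  - exists 1. rewrite Cmod_1, Cmod_0. repeat split. rewrite Cmult_0_r. reflexivity. ring.
  - assert (Hm := proj1 (Cmod_gt_0 z) Hz).
    assert (Hm' : RtoC (Cmod z) <> 0) by (intros E; apply RtoC_inj in E; lra).
    exists (z / Cmod z)%C. repeat split.
    + rewrite Cmod_div, Cmod_R, Rabs_pos_eq by (assumption || lra). field. lra.
    + replace (Cconj (z / Cmod z) * z)%C with (RtoC (Cmod z)). reflexivity.
      rewrite Cdiv_conj by assumption.
      replace (Cconj (Cmod z)) with (RtoC (Cmod z)) by (unfold Cconj, RtoC; simpl; now rewrite Ropp_0).
      transitivity ((z * Cconj z) / Cmod z)%C. 2: now field.
      rewrite <- Cmod2_conj. rewrite RtoC_pow. field. assumption.
    + now field.
Qed.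

Lemma tau_bound phi z : holomorphic_self_map phi -> Cmod z < 1 ->
  (1 - Cmod z ^ 2) * Cmod (C_derive phi z) <= 1 - Cmod (phi z) ^ 2.
Proof.
  intros H Hz. assert (Ht := schwarz_pick phi z H Hz). unfold tau in Ht.
  pose proof (Cmod_sq_lt_1 _ (proj1 H z Hz)).
  apply Rmult_le_compat_r with (r := 1 - Cmod (phi z) ^ 2) in Ht. 2: lra.
  unfold Rdiv in Ht. rewrite Rmult_assoc, Rinv_l in Ht by lra. lra.
Qed.

(* With [q t = Re (conj u * psi (t e))], Schwarz-Pick makes [(q - t) / (1 - t q)]
   nonincreasing, because the numerator of its derivative is
   [q' (1 - t^2) - (1 - q^2)]. *)
Lemma schwarz_lemma psi w : holomorphic_self_map psi -> psi 0 = 0 -> Cmod w < 1 -> Cmod (psi w) <= Cmod w.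
Proof.
  intros H H0 Hw.
  destruct (exists_direction w) as (e & He & _ & Ew).
  destruct (exists_direction (psi w)) as (u & Hu & Hpw & _).
  pose proof (Cmod_ge_0 w) as Hs. set (s := Cmod w) in *.
  set (q := fun t : R => Re (Cconj u * psi (0 + t * e)%C)).
  set (dq := fun t : R => Re (Cconj u * C_derive psi (0 + t * e)%C * e)).
  assert (Hte : forall t, 0 <= t -> Cmod (0 + t * e)%C = t).
  { intros t Ht. replace (0 + t * e)%C with (t * e)%C by ring. rewrite Cmod_mult, Cmod_R, He, Rabs_pos_eq; lra. }
  assert (Hq : forall t, 0 <= t <= s -> is_derive q t (dq t)).
  { intros t Ht. apply is_derive_along_line. apply H. rewrite Hte; lra. }
  assert (Hq1 : forall t, 0 <= t -> Rabs (q t) <= Cmod (psi (0 + t * e)%C)).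
  { intros t Ht. unfold q. eapply Rle_trans. apply re_le_Cmod. rewrite Cmod_mult, Cmod_conj, Hu. lra. }
  assert (Hdq : forall t, 0 <= t -> dq t <= Cmod (C_derive psi (0 + t * e)%C)).
  { intros t Ht. unfold dq. eapply Rle_trans. apply Re_le_Cmod. rewrite !Cmod_mult, Cmod_conj, Hu, He. lra. }
  assert (Hlt : forall t, 0 <= t <= s -> Rabs (q t) < 1).
  { intros t Ht. eapply Rle_lt_trans. apply Hq1; lra. apply H. rewrite Hte; lra. }
  assert (Hode : forall t, 0 <= t <= s -> dq t * (1 - t ^ 2) <= 1 - q t ^ 2).
  { intros t Ht. assert (Hc : Cmod (0 + t * e)%C < 1) by (rewrite Hte; lra).
    assert (Hb := tau_bound psi _ H Hc). rewrite Hte in Hb by lra.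
    assert (Ha := Hq1 t ltac:(lra)). assert (Hd := Hdq t ltac:(lra)).
    assert (q t ^ 2 <= Cmod (psi (0 + t * e)%C) ^ 2).
    { rewrite <- (pow2_abs (q t)). apply pow_incr. split. apply Rabs_pos. assumption. }
    assert (0 <= 1 - t ^ 2) by nra. nra. }
  assert (Hden : forall t, 0 <= t <= s -> 0 < 1 - t * q t).
  { intros t Ht. assert (Ha := Hlt t Ht). apply Rabs_def2 in Ha. nra. }
  set (k := fun t => (q t - t) / (1 - t * q t)).
  set (dk := fun t => ((dq t - 1) * (1 - t * q t) - (q t - t) * (- (q t + t * dq t))) / (1 - t * q t) ^ 2).
  assert (Hk : forall t, 0 <= t <= s -> is_derive k t (dk t)).
  { intros t Ht. assert (Hd := Hq t Ht). assert (Hn := Hden t Ht).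
    assert (Ed : Derive (fun x : R => q x) t = dq t) by (apply is_derive_unique; exact Hd).
    unfold k, dk. auto_derive.
    - repeat split; try (exists (dq t); exact Hd). lra.
    - rewrite Ed. field. lra. }
  destruct (MVT_gen k 0 s dk) as [x [Hx E]].
  - rewrite Rmin_left, Rmax_right by lra. intros x Hx. apply Hk; lra.
  - rewrite Rmin_left, Rmax_right by lra. intros x Hx. apply continuity_pt_filterlim.
    apply (ex_derive_continuous k). exists (dk x). now apply Hk.
  - rewrite Rmin_left, Rmax_right in Hx by lra.
    assert (Hdk : dk x <= 0).
    { unfold dk. assert (Hn := Hden x Hx). apply Rmult_le_reg_r with ((1 - x * q x) ^ 2). nra.
      unfold Rdiv. rewrite Rmult_assoc, Rinv_l by nra. specialize (Hode x Hx). nra. }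
    assert (E0 : k 0 = 0).
    { unfold k, q. replace (0 + 0%R * e)%C with (RtoC 0) by ring. rewrite H0.
      replace (Cconj u * 0)%C with (RtoC 0) by ring. simpl. field. }
    assert (Es : q s = Cmod (psi w)).
    { unfold q. replace (0 + s * e)%C with w. exact Hpw. rewrite Ew at 1. ring. }
    (* [k s <= k 0 = 0] amounts to [q s <= s], and [q s] is [|psi w|] by the choice of [u]. *)
    assert (Hks : k s <= 0) by nra. unfold k in Hks. assert (Hn := Hden s ltac:(lra)).
    apply Rmult_le_compat_r with (r := 1 - s * q s) in Hks. 2: lra.
    unfold Rdiv in Hks. rewrite Rmult_assoc, Rinv_l in Hks by lra. lra.
Qed.

Lemma Re_eq_1 (z : C) : Re z = 1 -> Cmod z <= 1 -> z = 1.
Proof.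
  intros H1 H2. assert (H := Cmod2_alt z). rewrite H1 in H. pose proof (Cmod_ge_0 z).
  assert (H3 : Im z = 0) by nra. destruct z as [x y]. unfold Re, Im in *; simpl in *. subst. reflexivity.
Qed.

Lemma unimodular_inv (l : C) : Cmod l = 1 -> (Cconj l * l)%C = 1.
Proof. intros H. rewrite Cmult_comm, <- Cmod2_conj, H. f_equal. ring. Qed.

(** The quotient [psi z / z] times [Cconj l] has modulus at most 1 by the Schwarz lemma and takes
    the value 1 at the centre. Equality in the mean value bound forces real part 1, hence value 1,
    at [w]. *)
Lemma schwarz_rigidity psi w : holomorphic_self_map psi -> psi 0 = 0 ->
  Cmod (C_derive psi 0) = 1 -> Cmod w < 1 -> psi w = (C_derive psi 0 * w)%C.
Proof.
  intros H H0 Hl Hw. set (l := C_derive psi 0) in *.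
  destruct (Ceq_dec w 0) as [->|Hw0]. { rewrite H0. ring. }
  destruct (exists_direction w) as (u & Hu & _ & Ew).
  assert (Hwp := proj1 (Cmod_gt_0 w) Hw0).
  assert (Hd0 : cdiff psi 0 l) by apply H, Cmod_lt_1_0.
  (* Rotating by [- u] puts [w] at the angle [PI], in the interior of the range that
     [circle_mean_eq] covers. *)
  set (g := fun z => (Cconj l * dquot psi l (0 + - u * z))%C).
  assert (Hdq : forall z, Cmod z < 1 -> Cmod (dquot psi l z) <= 1).
  { intros z Hz. unfold dquot. destruct Ceq_dec as [->|Hz0]. lra.
    rewrite H0. replace (psi z - 0)%C with (psi z) by ring. rewrite Cmod_div by assumption.
    assert (Hz1 := proj1 (Cmod_gt_0 z) Hz0). assert (Hs := schwarz_lemma psi z H H0 Hz).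
    apply Rmult_le_reg_r with (Cmod z). lra. unfold Rdiv. rewrite Rmult_assoc, Rinv_l; lra. }
  assert (Hrot : forall z, Cmod (0 + - u * z)%C = Cmod z).
  { intros z. replace (0 + - u * z)%C with (- u * z)%C by ring. rewrite Cmod_mult, Cmod_opp, Hu. ring. }
  assert (Hg1 : forall z, Cmod z < 1 -> Cmod (g z) <= 1).
  { intros z Hz. unfold g. rewrite Cmod_mult, Cmod_conj, Hl. rewrite Rmult_1_l. apply Hdq. now rewrite Hrot. }
  assert (Hgw : Re (g (cis (Cmod w) PI)) = 1).
  { pose proof PI_RGT_0. apply (circle_mean_eq g 1 (Cmod w) 1); try lra.
    - intros z Hz.
      assert (Hz0 : (0 + - u * z)%C <> 0) by (apply Cmod_gt_0; rewrite Hrot; lra).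
      assert (Hz1 : Cmod (0 + - u * z)%C < 1) by (rewrite Hrot; lra).
      destruct (dquot_cdiff psi l _ _ Hz0 (proj2 H _ Hz1)) as [n Hn].
      eexists. apply cdiff_scal. apply (cdiff_comp (dquot psi l) (fun z => 0 + - u * z)%C).
      exact Hn. apply cdiff_affine.
    - apply ccont_scal. intros eps He. destruct (dquot_ccont psi l Hd0 eps He) as [d [Hd Hd']].
      exists d. split; auto. intros z Hz. replace (0 + - u * 0)%C with (RtoC 0) by ring.
      apply Hd'. replace (0 + - u * z - 0)%C with (0 + - u * z)%C by ring. rewrite Hrot.
      replace (z - 0)%C with z in Hz by ring. exact Hz.
    - intros t. eapply Rle_trans. apply Re_le_Cmod. apply Hg1. rewrite Cmod_cis; lra.
    - unfold g. replace (0 + - u * 0)%C with (RtoC 0) by ring. rewrite dquot_0, unimodular_inv by assumption. reflexivity. }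
  assert (Eg : g (cis (Cmod w) PI) = 1).
  { apply Re_eq_1. assumption. apply Hg1. rewrite Cmod_cis; lra. }
  unfold g in Eg. replace (0 + - u * cis (Cmod w) PI)%C with w in Eg.
  - rewrite dquot_neq, H0 in Eg by assumption.
    transitivity (l * w * (Cconj l * ((psi w - 0) / w)))%C.
    transitivity ((Cconj l * l) * psi w)%C. rewrite unimodular_inv by assumption. ring. field. assumption.
    rewrite Eg. ring.
  - rewrite Ew at 1. unfold cis. rewrite cos_PI, sin_PI.
    replace (Cmod w * -1, Cmod w * 0) with (- RtoC (Cmod w))%C. ring.
    unfold Copp, RtoC; simpl. f_equal; ring.
Qed.

(** Rigidity makes [recentred phi a] multiplication by a unimodular [c], so
    [phi z = mob (phi a) (c * mob a z)]. Once [phi a = c * a] is known, [c] commutes out of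
    [mob (c * a)] and the two involutions cancel, leaving [c * z]. *)
Lemma tau_1_rotation phi a : holomorphic_self_map phi -> phi 0 = 0 -> Cmod a < 1 ->
  tau phi a = 1 -> is_rotation phi.
Proof.
  intros H H0 Ha Ht. set (c := C_derive (recentred phi a) 0).
  assert (Hc : Cmod c = 1) by (unfold c; now rewrite recentred_derive).
  assert (Hphi : forall z, Cmod z < 1 -> phi z = mob (phi a) (c * mob a z)).
  { intros z Hz. assert (Hm := mob_disc a z Ha Hz).
    unfold c; rewrite <- (schwarz_rigidity (recentred phi a) (mob a z)); auto.
    2: now apply recentred_holo. 2: apply recentred_0.
    unfold recentred. rewrite (mob_involutive a z) by assumption.
    symmetry. apply mob_involutive; now apply H. }
  assert (Hca : Cmod (c * a) < 1) by (rewrite Cmod_mult, Hc; lra).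
  (* The formula for [phi] at [0] says that [mob (phi a)] sends [c * a] to [0]; being an involution,
     it sends [0] to both [c * a] and [phi a]. *)
  assert (Eb : phi a = (c * a)%C).
  { assert (E := Hphi 0 Cmod_lt_1_0). rewrite H0, mob_0 in E.
    rewrite <- (mob_involutive (phi a) (c * a)), <- E, mob_0; auto. now apply H. }
  exists c. split; auto. intros z Hz.
  rewrite Hphi, Eb by assumption. clearbody c.
  assert (Hd := mob_den a z Ha Hz).
  assert (Haa := mob_den a a Ha Ha).
  assert (Hm := mob_den a (mob a z) Ha (mob_disc a z Ha Hz)).
  transitivity (c * mob a (mob a z))%C. 2: now rewrite mob_involutive.
  unfold mob at 1 3. rewrite Cmult_conj.
  replace (Cconj c * Cconj a * (c * mob a z))%C with ((Cconj c * c) * (Cconj a * mob a z))%C by ring.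
  rewrite unimodular_inv by assumption. replace (1 * (Cconj a * mob a z))%C with (Cconj a * mob a z)%C by ring.
  field. assumption.
Qed.

(** * Continuity of tau *)

Lemma derive_bound_lipschitz (f : C -> C) (r L : R) :
  (forall z, Cmod z <= r -> cdiff f z (C_derive f z) /\ Cmod (C_derive f z) <= L) ->
  forall z w, Cmod z <= r -> Cmod w <= r -> Cmod (f z - f w) <= L * Cmod (z - w).
Proof.
  intros Hf z w Hz Hw.
  destruct (exists_direction (f z - f w)) as (u & Hu & Hp & _).
  set (e := (z - w)%C).
  assert (Hseg : forall t, 0 <= t <= 1 -> Cmod (w + t * e)%C <= r).
  { intros t Ht. replace (w + t * e)%C with (RtoC (1 - t) * w + t * z)%C.
    2: { unfold e. rewrite RtoC_minus. ring. }
    eapply Rle_trans. apply Cmod_triangle. rewrite !Cmod_mult, !Cmod_R, !Rabs_pos_eq by lra. nra. }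
  set (q := fun t : R => Re (Cconj u * f (w + t * e)%C)).
  set (dq := fun t : R => Re (Cconj u * C_derive f (w + t * e)%C * e)).
  assert (Hq : forall t, 0 <= t <= 1 -> is_derive q t (dq t)).
  { intros t Ht. apply is_derive_along_line, Hf, Hseg, Ht. }
  destruct (MVT_gen q 0 1 dq) as [x [Hx E]].
  - rewrite Rmin_left, Rmax_right by lra. intros x Hx. apply Hq; lra.
  - rewrite Rmin_left, Rmax_right by lra. intros x Hx. apply continuity_pt_filterlim.
    apply (ex_derive_continuous q). exists (dq x). now apply Hq.
  - rewrite Rmin_left, Rmax_right in Hx by lra.
    assert (E1 : q 1 - q 0 = Cmod (f z - f w)).
    { rewrite <- Hp. unfold q. replace (w + 1%R * e)%C with z by (unfold e; ring).
      replace (w + 0%R * e)%C with w by ring. unfold Re; simpl. ring. }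
    rewrite <- E1, E, Rminus_0_r, Rmult_1_r. unfold dq.
    eapply Rle_trans. apply Re_le_Cmod. rewrite !Cmod_mult, Cmod_conj, Hu, Rmult_1_l.
    apply Rmult_le_compat_r. apply Cmod_ge_0. apply Hf, Hseg, Hx.
Qed.

(** Schwarz-Pick bounds [|phi'(z)|] by [1 / (1 - |z| ^ 2)], because [1 - |phi z| ^ 2] is at most
    1. *)
Lemma holomorphic_self_map_lipschitz phi r : holomorphic_self_map phi -> 0 <= r < 1 ->
  forall z w, Cmod z <= r -> Cmod w <= r -> Cmod (phi z - phi w) <= / (1 - r ^ 2) * Cmod (z - w).
Proof.
  intros H Hr. apply derive_bound_lipschitz. intros z Hz. split. apply H; lra.
  assert (Hz1 : Cmod z < 1) by lra.
  assert (Hb := tau_bound phi z H Hz1). pose proof (Cmod_ge_0 z).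
  assert (Cmod z ^ 2 <= r ^ 2) by (apply pow_incr; lra).
  assert (0 < 1 - r ^ 2) by nra.
  pose proof (pow2_ge_0 (Cmod (phi z))). pose proof (Cmod_ge_0 (C_derive phi z)).
  apply Rmult_le_reg_l with (1 - r ^ 2). lra. rewrite Rinv_r by lra. nra.
Qed.

Lemma cdiff_translate f (z x l : C) : cdiff f (z + x) l -> cdiff (fun w => f (z + w)%C) x l.
Proof.
  intros H. refine (cdiff_eq _ _ _ _ _ (fun _ => eq_refl) _ (cdiff_comp f (fun w => z + w)%C x l _ H (cdiff_plus _ _ _ _ _ (cdiff_const z x) (cdiff_id x)))).
  ring.
Qed.

(** The function [y -> phi (w + y) - phi (z + y)] has derivative [phi'(w) - phi'(z)] at [0] and is
    of size [|w - z|] by the Lipschitz bound, so the Cauchy estimate makes [phi'] locally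
    Lipschitz. *)
Lemma derive_ccont phi z : holomorphic_self_map phi -> Cmod z < 1 -> ccont (C_derive phi) z.
Proof.
  intros H Hz. pose proof (Cmod_ge_0 z).
  (* A quarter, because [w] may lie [h] away from [z] and translates by up to [2 * h] are used:
     [|z| + 3 * h = 1 - h = r]. *)
  set (h := (1 - Cmod z) / 4). assert (Hh : 0 < h) by (unfold h; lra).
  set (r := 1 - h). assert (Hr : 0 <= r < 1) by (unfold r, h; lra).
  set (L := / (1 - r ^ 2)). assert (HL : 0 < L) by (apply Rinv_0_lt_compat; nra).
  assert (Hlip : forall w, Cmod (w - z) < h ->
     Cmod (C_derive phi w - C_derive phi z) <= 2 * L * Cmod (w - z) / h).
  { intros w Hw.
    assert (Hw1 : Cmod w < Cmod z + h).
    { replace w with (w - z + z)%C by ring. eapply Rle_lt_trans. apply Cmod_triangle. lra. }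
    assert (Hball : forall x y, Cmod x < Cmod z + h -> Cmod y <= 2 * h -> Cmod (x + y) <= r).
    { intros x y Hx Hy. eapply Rle_trans. apply Cmod_triangle. unfold r, h in *. lra. }
    assert (Hzz : Cmod z < Cmod z + h) by lra.
    apply (cauchy_estimate (fun y => phi (w + y) - phi (z + y))%C (2 * h) h).
    - intros y Hy. eexists. apply cdiff_minus; apply cdiff_translate; apply H.
      apply Rle_lt_trans with r. apply Hball; lra. lra.
      apply Rle_lt_trans with r. apply Hball; lra. lra.
    - apply cdiff_minus; apply cdiff_translate; rewrite Cplus_0_r; apply H. unfold h in *; lra. lra.
    - lra.
    - intros y Hy. eapply Rle_trans. apply Cmod_triangle_minus.
      assert (A : forall y, Cmod y <= h -> Cmod (phi (w + y) - phi (z + y))%C <= L * Cmod (w - z)).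
      { intros x Hx. replace (w - z)%C with ((w + x) - (z + x))%C by ring.
        apply (holomorphic_self_map_lipschitz phi r H Hr); apply Hball; lra. }
      assert (A1 := A y ltac:(lra)). assert (A2 := A 0 ltac:(rewrite Cmod_0; lra)). lra. }
  intros eps He.
  set (k := eps * h / (2 * L)).
  assert (Hk : 0 < k) by (apply Rdiv_lt_0_compat; nra).
  exists (Rmin h k). split. now apply Rmin_pos.
  intros w Hw. pose proof (Rmin_l h k). pose proof (Rmin_r h k).
  eapply Rle_lt_trans. apply Hlip. lra.
  assert (Hwk : Cmod (w - z) < k) by lra. unfold k in Hwk.
  apply Rmult_lt_reg_r with h. lra. unfold Rdiv at 1. rewrite Rmult_assoc, Rinv_l, Rmult_1_r by lra.
  apply Rmult_lt_compat_l with (r := 2 * L) in Hwk. 2: lra.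
  replace (2 * L * (eps * h / (2 * L))) with (eps * h) in Hwk by (field; lra). lra.
Qed.

Lemma continuous_Cmod_comp (f : C -> C) (z : C) :
  ccont f z -> continuous (T := C_UniformSpace) (U := R_UniformSpace) (fun w => Cmod (f w)) z.
Proof.
  intros H P [eps HP]. apply locally_C. destruct (H eps (cond_pos eps)) as [d [Hd H']].
  exists (mkposreal d Hd). intros w Hw. apply HP.
  unfold ball; simpl; unfold AbsRing_ball, abs, minus, plus, opp; simpl.
  assert (Hc : Cmod (f w - f z) < eps) by (apply H'; exact Hw).
  pose proof (Cmod_triangle_rev (f w) (f z)). pose proof (Cmod_triangle_rev (f z) (f w)) as H2.
  rewrite (Cmod_minus_sym (f z)) in H2. apply Rabs_def1; lra.
Qed.

Lemma continuous_tau phi z : holomorphic_self_map phi -> Cmod z < 1 ->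
  continuous (T := C_UniformSpace) (U := R_UniformSpace) (tau phi) z.
Proof.
  intros H Hz. unfold tau.
  assert (C1 := continuous_Cmod_comp _ _ (cdiff_ccont _ _ _ (cdiff_id z))).
  assert (C2 := continuous_Cmod_comp _ _ (cdiff_ccont _ _ _ (proj2 H z Hz))).
  assert (C3 := continuous_Cmod_comp _ _ (derive_ccont phi z H Hz)).
  assert (Hsq : forall x, continuous (fun x => 1 - x ^ 2) x).
  { intros x. apply (ex_derive_continuous (fun x => 1 - x ^ 2)). auto_derive; auto. }
  apply (continuous_mult (K := R_AbsRing) (fun w => (1 - Cmod w ^ 2) * Cmod (C_derive phi w)) (fun w => / (1 - Cmod (phi w) ^ 2))).
  - apply (continuous_mult (K := R_AbsRing) (fun w => (1 - Cmod w ^ 2)) (fun w => Cmod (C_derive phi w))).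
    apply (continuous_comp _ (fun x => 1 - x ^ 2) _ C1). apply Hsq. exact C3.
  - apply (continuous_comp _ (fun x => / (1 - x ^ 2)) _ C2).
    apply (ex_derive_continuous (fun x => / (1 - x ^ 2))). auto_derive.
    pose proof (Cmod_sq_lt_1 _ (proj1 H z Hz)). simpl in *. lra.
Qed.

(** Compactness of [|z| <= r], obtained from the bisection that also serves Goursat's argument:
    continuity of [tau] gives a local gap, and the minimum over four quarters is a gap for the
    box. *)
Lemma tau_gap phi r : holomorphic_self_map phi -> (forall z, Cmod z < 1 -> tau phi z < 1) -> r < 1 ->
  exists eta, 0 < eta /\ forall z, Cmod z <= r -> tau phi z <= 1 - eta.
Proof.
  intros H Hlt Hr.
  destruct (rectangle_bisection (fun a b c d => exists eta, 0 < eta /\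
     forall u v, a <= u <= b -> c <= v <= d -> Cmod (u, v) <= r -> tau phi (u, v) <= 1 - eta) (-1) 1 (-1) 1)
    as [eta [He Heta]]; try lra.
  - intros a b c d _ _ _ _ _ _ [e1 [P1 H1]] [e2 [P2 H2]] [e3 [P3 H3]] [e4 [P4 H4]].
    exists (Rmin (Rmin e1 e2) (Rmin e3 e4)). split. repeat apply Rmin_pos; assumption.
    assert (M1 := Rmin_l (Rmin e1 e2) (Rmin e3 e4)). assert (M2 := Rmin_r (Rmin e1 e2) (Rmin e3 e4)).
    assert (M3 := Rmin_l e1 e2). assert (M4 := Rmin_r e1 e2).
    assert (M5 := Rmin_l e3 e4). assert (M6 := Rmin_r e3 e4).
    intros u v Hu Hv Huv.
    destruct (Rle_dec u ((a + b) / 2)), (Rle_dec v ((c + d) / 2)).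
    + specialize (H1 u v ltac:(lra) ltac:(lra) Huv). lra.
    + specialize (H3 u v ltac:(lra) ltac:(lra) Huv). lra.
    + specialize (H2 u v ltac:(lra) ltac:(lra) Huv). lra.
    + specialize (H4 u v ltac:(lra) ltac:(lra) Huv). lra.
  - intros x y _ _.
    assert (Hnear : forall e a b c d u v, a <= x <= b -> c <= y <= d -> b - a < e / 2 -> d - c < e / 2 ->
      a <= u <= b -> c <= v <= d -> Cmod ((u, v) - (x, y)) < e).
    { intros. eapply Rle_lt_trans. apply Cmod_le_2Rmax.
      assert (Rmax (Rabs (u - x)) (Rabs (v - y)) < e / 2). apply Rmax_lub_lt; apply Rabs_def1; lra.
      change (Re ((u, v) - (x, y))) with (u - x). change (Im ((u, v) - (x, y))) with (v - y). lra. }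
    (* A small box around a point outside [|z| <= r] misses that disc, so the claim is vacuous
       there. *)
    destruct (Rlt_le_dec r (Cmod (x, y))) as [Hout|Hin].
    + exists ((Cmod (x, y) - r) / 2). split. lra.
      intros a b c d _ _ _ _ Hx Hy Hw Hh. exists 1. split. lra. intros u v Hu Hv Huv. exfalso.
      assert (Hn := Hnear _ a b c d u v Hx Hy Hw Hh Hu Hv).
      assert (Ht := Cmod_triangle_rev (x, y) (u, v)). rewrite Cmod_minus_sym in Ht. lra.
    + assert (Hxy : Cmod (x, y) < 1) by lra.
      assert (Hgap := Hlt _ Hxy). set (g := (1 - tau phi (x, y)) / 2).
      assert (Hg : 0 < g) by (unfold g; lra).
      assert (Hc := continuous_tau phi (x, y) H Hxy).
      assert (Hloc := Hc (fun s => Rabs (s - tau phi (x, y)) < g)). destruct Hloc as [d Hd].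
      { exists (mkposreal g Hg). intros s Hs. exact Hs. }
      pose proof (cond_pos d) as Hdp.
      exists (d / 2). split. lra.
      intros a b c d' _ _ _ _ Hx Hy Hw Hh. exists g. split. assumption.
      intros u v Hu Hv Huv. specialize (Hd (u, v)).
      assert (Hb : Rabs (tau phi (u, v) - tau phi (x, y)) < g).
      { apply Hd. apply C_NormedModule_mixin_compat1. apply (Hnear d a b c d'); assumption. }
      apply Rabs_def2 in Hb. unfold g in *. lra.
  - exists eta. split. assumption. intros [u v] Hz.
    assert (H1 := re_le_Cmod (u, v)). assert (H2 := im_le_Cmod (u, v)). unfold Re, Im in H1, H2; simpl in H1, H2.
    apply Heta; try assumption; apply Rabs_le_between; lra.
Qed.

(** * Bloch densities *)

Lemma unit_disc_locally_2d (x y : R) : unit_disc (x, y) -> locally_2d (fun u v => unit_disc (u, v)) x y.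
Proof.
  unfold unit_disc. intros H. assert (Hd : 0 < (1 - Cmod (x, y)) / 2) by lra.
  exists (mkposreal _ Hd). simpl. intros u v Hu Hv.
  assert (Hm : Cmod ((u, v) - (x, y))%C <= 2 * Rmax (Rabs (u - x)) (Rabs (v - y)))
    by exact (Cmod_le_2Rmax ((u, v) - (x, y))%C).
  assert (Hr := Rmax_lub_lt _ _ _ Hu Hv).
  assert (Ht := Cmod_triangle_rev (u, v) (x, y)). lra.
Qed.

(** The chain rule needs a total derivative, while [ex_diff_n] speaks of partial ones. The
    [x]-derivative exists near the point and is continuous there, and this together with the
    [y]-derivative at the point suffices. *)
Lemma C2_on_disc_differentiable (u : R -> R -> R) (x y : R) : C2_on_disc u -> unit_disc (x, y) ->
  differentiable_pt_lim u x y (Derive (fun t => u t y) x) (Derive (fun t => u x t) y).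
Proof.
  intros H Hxy. apply filterdiff_differentiable_pt_lim.
  apply (is_derive_filterdiff u x y (fun a b => Derive (fun t => u t b) a)).
  - assert (Hl := unit_disc_locally_2d x y Hxy). apply locally_2d_locally in Hl.
    revert Hl. apply filter_imp. intros [a b] Hab. apply Derive_correct. apply (H a b Hab).
  - apply Derive_correct. apply (H x y Hxy).
  - apply (continuity_2d_pt_filterlim (fun a b => Derive (fun t => u t b) a)).
    destruct (H x y Hxy) as (_ & _ & _ & [Hc _] & _). exact Hc.
Qed.

Lemma cdiff_dz F z l : cdiff F z l -> C_dz F z = l /\ C_dzbar F z = 0.
Proof.
  intros H. destruct z as [x y].
  destruct (differentiable_pt_lim_unique _ _ _ _ _ (cdiff_differentiable_re F x y l H)) as [E1 E2].
  destruct (differentiable_pt_lim_unique _ _ _ _ _ (cdiff_differentiable_im F x y l H)) as [E3 E4].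
  unfold C_dz, C_dzbar, C_dx, C_dy. unfold Re, Im in *; cbn [fst snd]. rewrite E1, E2, E3, E4. destruct l as [a b].
  cbn [fst snd]. unfold Cmult, Cplus, Cminus, Copp, Cinv, Ci, RtoC; simpl. split; f_equal; field.
Qed.

(** Holomorphy of [phi] keeps the two Wirtinger derivatives from mixing, and both factors have
    modulus [|phi'|]. Hence their sum in the Bloch density picks up a single factor. *)
Lemma harmonic_comp_dz (f phi : C -> C) (z : C) : harmonic_on_disc f -> holomorphic_self_map phi -> Cmod z < 1 ->
  C_dz (fun w => f (phi w)) z = (C_dz f (phi z) * C_derive phi z)%C /\
  C_dzbar (fun w => f (phi w)) z = (C_dzbar f (phi z) * Cconj (C_derive phi z))%C.
Proof.
  intros (Hu & Hv & _) [Hd Hphi] Hz. specialize (Hd z Hz). specialize (Hphi z Hz).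
  set (l := C_derive phi z) in *. clearbody l. destruct z as [x y].
  assert (Hr := cdiff_differentiable_re phi x y l Hphi). assert (Hi := cdiff_differentiable_im phi x y l Hphi).
  assert (Ep : phi (x, y) = (re_part phi x y, im_part phi x y)).
  { unfold re_part, im_part. now destruct (phi (x, y)). }
  rewrite Ep in *.
  assert (HU := differentiable_pt_lim_comp _ _ _ x y _ _ _ _ _ _ (C2_on_disc_differentiable _ _ _ Hu Hd) Hr Hi).
  assert (HV := differentiable_pt_lim_comp _ _ _ x y _ _ _ _ _ _ (C2_on_disc_differentiable _ _ _ Hv Hd) Hr Hi).
  assert (EU : forall a b, re_part f (re_part phi a b) (im_part phi a b) = re_part (fun w => f (phi w)) a b).
  { intros a b. unfold re_part, im_part. now destruct (phi (a, b)). }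
  assert (EV : forall a b, im_part f (re_part phi a b) (im_part phi a b) = im_part (fun w => f (phi w)) a b).
  { intros a b. unfold re_part, im_part. now destruct (phi (a, b)). }
  apply (differentiable_pt_lim_ext _ (re_part (fun w => f (phi w)))) in HU.
  2: { apply locally_2d_forall, EU. }
  apply (differentiable_pt_lim_ext _ (im_part (fun w => f (phi w)))) in HV.
  2: { apply locally_2d_forall, EV. }
  destruct (differentiable_pt_lim_unique _ _ _ _ _ HU) as [E1 E2].
  destruct (differentiable_pt_lim_unique _ _ _ _ _ HV) as [E3 E4].
  unfold C_dz, C_dzbar, C_dx, C_dy. unfold Re, Im in *; cbn [fst snd]. rewrite E1, E2, E3, E4.
  destruct l as [a b]. set (p := re_part phi x y). set (q := im_part phi x y).
  cbn [fst snd]. unfold Cmult, Cplus, Cminus, Copp, Cinv, Ci, RtoC, Cconj; simpl. split; f_equal; field.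
Qed.

Definition bloch_density (f : C -> C) (z : C) : R :=
  (1 - Cmod z ^ 2) * (Cmod (C_dz f z) + Cmod (C_dzbar f z)).

Lemma bloch_density_nonneg f z : Cmod z < 1 -> 0 <= bloch_density f z.
Proof.
  intros Hz. apply Rmult_le_pos. pose proof (Cmod_sq_lt_1 z Hz); lra.
  apply Rplus_le_le_0_compat; apply Cmod_ge_0.
Qed.

Lemma bloch_density_comp f phi z : harmonic_on_disc f -> holomorphic_self_map phi -> Cmod z < 1 ->
  bloch_density (fun w => f (phi w)) z = tau phi z * bloch_density f (phi z).
Proof.
  intros Hf H Hz. unfold bloch_density. destruct (harmonic_comp_dz f phi z Hf H Hz) as [-> ->].
  rewrite !Cmod_mult, Cmod_conj. unfold tau. pose proof (Cmod_sq_lt_1 _ (proj1 H z Hz)). field. lra.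
Qed.

(** * Harmonicity and densities of the test functions *)

Lemma ccont_continuity_2d (F : C -> C) (c : C) (x y : R) : ccont F (x, y) ->
  continuity_2d_pt (fun u v => Re (c * F (u, v))) x y.
Proof.
  intros H [eps He]. destruct (ccont_scal c F (x, y) H eps He) as [d [Hd H']].
  assert (Hd2 : 0 < d / 2) by lra.
  exists (mkposreal _ Hd2). simpl. intros u v Hu Hv.
  assert (Hm : Cmod ((u, v) - (x, y))%C <= 2 * Rmax (Rabs (u - x)) (Rabs (v - y)))
    by exact (Cmod_le_2Rmax ((u, v) - (x, y))%C).
  assert (Hr := Rmax_lub_lt _ _ _ Hu Hv).
  eapply Rle_lt_trans. 2: apply (H' (u, v)); lra.
  eapply Rle_trans. 2: apply re_le_Cmod. right. apply f_equal. unfold Re; simpl; ring.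
Qed.

(** The factor [c] selects the component, [1] for the real and [- Ci] for the imaginary part. A
    [y]-derivative merely multiplies it by [Ci], so a single induction handles all partial
    derivatives. *)
Lemma cdiff_partials (F : C -> C) (c l : C) (x y : R) : cdiff F (x, y) l ->
  is_derive (fun u => Re (c * F (u, y))) x (Re (c * l)) /\
  is_derive (fun v => Re (c * F (x, v))) y (Re (c * Ci * l)).
Proof.
  intros H. apply (cdiff_scal c) in H. apply cdiff_differentiable_re in H.
  assert (Hx := derivable_pt_lim_comp_2d _ (fun u => u) (fun _ => y) x _ _ _ _ H (derivable_pt_lim_id x) (derivable_pt_lim_const y x)).
  assert (Hy := derivable_pt_lim_comp_2d _ (fun _ => x) (fun v => v) y _ _ _ _ H (derivable_pt_lim_const x y) (derivable_pt_lim_id y)).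
  apply is_derive_Reals in Hx. apply is_derive_Reals in Hy.
  split.
  - replace (Re (c * l)) with (Re (c * l) * 1 + - Im (c * l) * 0) by ring. exact Hx.
  - replace (Re (c * Ci * l)) with (Re (c * l) * 0 + - Im (c * l) * 1). exact Hy.
    unfold Re, Im, Ci; simpl. ring.
Qed.

(** Mirrors the recursion of [ex_diff_n]. The successive derivatives are supplied explicitly for
    each test function, which avoids proving that holomorphic functions are smooth. *)
Fixpoint holomorphic_n (n : nat) (F : C -> C) : Prop :=
  match n with
  | O => forall z, Cmod z < 1 -> ccont F z
  | S n => exists F', (forall z, Cmod z < 1 -> cdiff F z (F' z)) /\ holomorphic_n n F'
  end.

Lemma holomorphic_n_ex_diff_n n F (c : C) x y : holomorphic_n n F -> unit_disc (x, y) ->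
  ex_diff_n (fun u v => Re (c * F (u, v))) n x y.
Proof.
  revert F c x y. induction n as [|n IH]; intros F c x y HF Hxy.
  - split; auto. apply ccont_continuity_2d, HF, Hxy.
  - destruct HF as [F' [HF HF']].
    assert (Hp : forall a b, unit_disc (a, b) -> _) by (intros a b Hab; exact (cdiff_partials F c _ a b (HF _ Hab))).
    split; [|split; [|split; [|split]]].
    + apply ccont_continuity_2d. eapply cdiff_ccont. apply HF, Hxy.
    + eexists. apply (Hp x y Hxy).
    + eexists. apply (Hp x y Hxy).
    + apply (ex_diff_n_ext_loc (fun u v => Re (c * F' (u, v)))). 2: now apply IH.
      generalize (unit_disc_locally_2d x y Hxy). apply locally_2d_impl, locally_2d_forall.
      intros a b Hab. symmetry. apply is_derive_unique, (Hp a b Hab).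
    + apply (ex_diff_n_ext_loc (fun u v => Re (c * Ci * F' (u, v)))). 2: now apply IH.
      generalize (unit_disc_locally_2d x y Hxy). apply locally_2d_impl, locally_2d_forall.
      intros a b Hab. symmetry. apply is_derive_unique, (Hp a b Hab).
Qed.

(** Two [y]-derivatives contribute [Ci * Ci = -1], against [1] for two [x]-derivatives. *)
Lemma holomorphic_laplacian F (c : C) x y : holomorphic_n 2 F -> unit_disc (x, y) ->
  laplacian (fun u v => Re (c * F (u, v))) x y = 0.
Proof.
  intros [F' [HF [F'' [HF' _]]]] Hxy.
  assert (Hp : forall a b, unit_disc (a, b) -> _) by (intros a b Hab; exact (cdiff_partials F c _ a b (HF _ Hab))).
  assert (Hl := unit_disc_locally_2d x y Hxy).
  change (Derive (Derive (fun u => Re (c * F (u, y)))) x + Derive (Derive (fun v => Re (c * F (x, v)))) y = 0).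
  rewrite (Derive_ext_loc (Derive (fun u => Re (c * F (u, y)))) (fun t => Re (c * F' (t, y)))).
  2: { generalize (locally_2d_1d_const_y _ _ _ Hl). apply filter_imp. intros t Ht.
       apply is_derive_unique, (Hp t y Ht). }
  rewrite (Derive_ext_loc (Derive (fun v => Re (c * F (x, v)))) (fun t => Re (c * Ci * F' (x, t)))).
  2: { generalize (locally_2d_1d_const_x _ _ _ Hl). apply filter_imp. intros t Ht.
       apply is_derive_unique, (Hp x t Ht). }
  assert (D1 := is_derive_unique _ _ _ (proj1 (cdiff_partials F' c _ x y (HF' _ Hxy)))).
  assert (D2 := is_derive_unique _ _ _ (proj2 (cdiff_partials F' (c * Ci) _ x y (HF' _ Hxy)))).
  etransitivity. apply f_equal2. exact D1. exact D2.
  unfold Re, Ci; simpl. ring.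
Qed.

Lemma holomorphic_harmonic F : holomorphic_n 2 F -> harmonic_on_disc F.
Proof.
  intros HF.
  assert (Er : forall u v, Re (1 * F (u, v)) = re_part F u v).
  { intros. rewrite Cmult_1_l. reflexivity. }
  assert (Ei : forall u v, Re (- Ci * F (u, v)) = im_part F u v).
  { intros. unfold im_part, Re, Im, Ci; simpl. ring. }
  assert (Lext : forall g h x y, (forall u v, g u v = h u v) -> laplacian g x y = laplacian h x y).
  { intros g h x y E. unfold laplacian, partial_derive. simpl.
    f_equal; apply Derive_ext; intros; apply Derive_ext; intros; apply E. }
  split; [|split].
  - intros x y Hxy. eapply ex_diff_n_ext_loc. apply locally_2d_forall, Er.
    now apply holomorphic_n_ex_diff_n.
  - intros x y Hxy. eapply ex_diff_n_ext_loc. apply locally_2d_forall, Ei.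
    now apply holomorphic_n_ex_diff_n.
  - intros x y Hxy. rewrite <- (Lext _ _ x y Er), <- (Lext _ _ x y Ei).
    split; now apply holomorphic_laplacian.
Qed.

Lemma harmonic_translation (c : C) : harmonic_on_disc (fun z => c + z)%C.
Proof.
  apply holomorphic_harmonic. exists (fun _ => RtoC 1). split.
  - intros z _. refine (cdiff_eq _ _ _ _ _ _ eq_refl (cdiff_affine c 1 z)). intros w; ring.
  - exists (fun _ => RtoC 0). split. intros; apply cdiff_const.
    intros z _. eapply cdiff_ccont, cdiff_const.
Qed.

Lemma harmonic_mob (a : C) : Cmod a < 1 -> harmonic_on_disc (mob a).
Proof.
  intros Ha. apply holomorphic_harmonic.
  (* Since [iv' = Cconj a * iv ^ 2] and [mob a] has derivative [K * iv ^ 2], the derivatives needed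
     are multiples of powers of [iv]. *)
  set (iv := fun z => (/ (1 + - Cconj a * z))%C).
  assert (Hiv : forall z, Cmod z < 1 -> cdiff iv z (Cconj a * (iv z * iv z))).
  { intros z Hz. assert (Hd : (1 + - Cconj a * z)%C <> 0).
    { intros E. apply (mob_den a z Ha Hz). rewrite <- E. ring. }
    refine (cdiff_eq _ _ _ _ _ (fun _ => eq_refl) _ (cdiff_comp Cinv _ z _ _ (cdiff_inv _ Hd) (cdiff_affine 1 (- Cconj a) z))).
    unfold iv. field. assumption. }
  set (K := (Cconj a * a - 1)%C).
  exists (fun z => K * (iv z * iv z))%C. split.
  { intros z Hz. refine (cdiff_eq _ _ _ _ _ (fun _ => eq_refl) _ (cdiff_mob a z Ha Hz)).
    assert (Hd := mob_den a z Ha Hz). unfold mob_deriv, iv, K.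
    replace (1 + - Cconj a * z)%C with (1 - Cconj a * z)%C by ring. field. assumption. }
  exists (fun z => 2 * K * Cconj a * (iv z * (iv z * iv z)))%C. split.
  - intros z Hz. refine (cdiff_eq _ _ _ _ _ (fun _ => eq_refl) _
      (cdiff_scal K _ _ _ (cdiff_mult _ _ _ _ _ (Hiv z Hz) (Hiv z Hz)))). ring.
  - intros z Hz. eapply cdiff_ccont.
    apply (cdiff_scal (2 * K * Cconj a)). apply cdiff_mult. now apply Hiv. apply cdiff_mult; now apply Hiv.
Qed.

Lemma bloch_density_translation (c z : C) : bloch_density (fun z => c + z)%C z = 1 - Cmod z ^ 2.
Proof.
  unfold bloch_density.
  assert (H : cdiff (fun z => c + z)%C z 1).
  { refine (cdiff_eq _ _ _ _ _ _ eq_refl (cdiff_affine c 1 z)). intros w; ring. }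
  destruct (cdiff_dz _ _ _ H) as [-> ->]. rewrite Cmod_1, Cmod_0. ring.
Qed.

Lemma bloch_density_mob (a z : C) : Cmod a < 1 -> Cmod z < 1 ->
  bloch_density (mob a) z = 1 - Cmod (mob a z) ^ 2.
Proof.
  intros Ha Hz. unfold bloch_density. destruct (cdiff_dz _ _ _ (cdiff_mob a z Ha Hz)) as [-> ->].
  rewrite Cmod_mob_deriv, mob_identity, Cmod_0 by assumption. unfold Rdiv. ring.
Qed.

Lemma continuity_2d_pt_hypot (g h : R -> R -> R) (x y : R) :
  continuity_2d_pt g x y -> continuity_2d_pt h x y ->
  continuity_2d_pt (fun u v => sqrt (g u v * g u v + h u v * h u v)) x y.
Proof.
  intros Hg Hh.
  apply (continuity_1d_2d_pt_comp sqrt (fun u v => g u v * g u v + h u v * h u v)).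
  - apply continuity_pt_sqrt. nra.
  - apply continuity_2d_pt_plus; now apply continuity_2d_pt_mult.
Qed.

Lemma continuous_bloch_density f z : harmonic_on_disc f -> Cmod z < 1 ->
  continuous (T := C_UniformSpace) (U := R_UniformSpace) (bloch_density f) z.
Proof.
  intros (Hu & Hv & _) Hz. destruct z as [x y].
  destruct (Hu x y Hz) as (_ & _ & _ & [U1 _] & [U2 _]).
  destruct (Hv x y Hz) as (_ & _ & _ & [V1 _] & [V2 _]).
  assert (Hc : continuity_2d_pt (fun u v => bloch_density f (u, v)) x y).
  2: { apply continuity_2d_pt_filterlim in Hc. eapply filterlim_ext. 2: exact Hc. now intros [a b]. }
  (* The density written out in the four first partial derivatives, so that its continuity follows
     from the shape of the expression. *)
  apply continuity_2d_pt_ext with (fun x y =>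
    (1 - (x * x + y * y)) * (
      sqrt ((/ 2 * (Derive (fun t => re_part f t y) x + Derive (fun t => im_part f x t) y)) * (/ 2 * (Derive (fun t => re_part f t y) x + Derive (fun t => im_part f x t) y))
      + (/ 2 * (Derive (fun t => im_part f t y) x - Derive (fun t => re_part f x t) y)) * (/ 2 * (Derive (fun t => im_part f t y) x - Derive (fun t => re_part f x t) y))) +
      sqrt ((/ 2 * (Derive (fun t => re_part f t y) x - Derive (fun t => im_part f x t) y)) * (/ 2 * (Derive (fun t => re_part f t y) x - Derive (fun t => im_part f x t) y))
      + (/ 2 * (Derive (fun t => im_part f t y) x + Derive (fun t => re_part f x t) y)) * (/ 2 * (Derive (fun t => im_part f t y) x + Derive (fun t => re_part f x t) y))))).
  - intros u v. unfold bloch_density. rewrite Cmod2_alt. unfold C_dz, C_dzbar, C_dx, C_dy, Cmod, Re, Im.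
    cbn [fst snd]. f_equal. ring. f_equal; f_equal; simpl; field.
  - repeat first [ apply continuity_2d_pt_mult | apply continuity_2d_pt_plus | apply continuity_2d_pt_opp
      | apply continuity_2d_pt_const | apply continuity_2d_pt_id1 | apply continuity_2d_pt_id2
      | assumption | apply continuity_2d_pt_hypot ].
Qed.

(** * Isometries *)

Definition bloch_sup (f : C -> C) : Rbar :=
  Lub_Rbar (fun r => exists z, unit_disc z /\ r = bloch_density f z).

Lemma HB_norm_bloch_sup f : HB_norm f = Rbar_plus (Cmod (f 0)) (bloch_sup f).
Proof. reflexivity. Qed.

Lemma bloch_sup_unique f (l : R) :
  (forall z, Cmod z < 1 -> bloch_density f z <= l) ->
  (exists z, Cmod z < 1 /\ bloch_density f z = l) -> bloch_sup f = l.
Proof.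
  intros H1 [z [Hz E]]. apply is_lub_Rbar_unique. split.
  - intros x [w [Hw ->]]. now apply H1.
  - intros b Hb. apply Hb. now exists z.
Qed.

Lemma bloch_sup_approx f (l e : R) : bloch_sup f = l -> 0 < e ->
  exists z, Cmod z < 1 /\ l - e < bloch_density f z.
Proof.
  intros E He. apply NNPP. intros Hno.
  destruct (Lub_Rbar_correct (fun r => exists z, unit_disc z /\ r = bloch_density f z)) as [_ Hl].
  fold (bloch_sup f) in Hl. rewrite E in Hl.
  assert (Hb : Rbar_le l (Finite (l - e))).
  { apply Hl. intros x [z [Hz ->]]. simpl. apply Rnot_lt_le. intros Hlt. apply Hno. now exists z. }
  simpl in Hb. lra.
Qed.

Lemma analytic_holomorphic phi : analytic_self_map phi -> holomorphic_self_map phi.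
Proof. intros [H1 H2]. split. exact H1. intros z Hz. apply ex_derive_cdiff, H2, Hz. Qed.

(** Composition cannot raise the supremum because [tau] is at most 1, and every value of the density
    of [f] is a limit of densities of the composite. The sequences may lie anywhere in the disc, so
    that rotations are covered too, by constant sequences. *)
Lemma isometry_of_sequences phi : holomorphic_self_map phi -> phi 0 = 0 ->
  (forall a, unit_disc a -> exists z : nat -> C, (forall n, unit_disc (z n)) /\
     filterlim (fun n => phi (z n)) eventually (@locally C_UniformSpace a) /\
     is_lim_seq (fun n => tau phi (z n)) 1) ->
  composition_isometry phi.
Proof.
  intros H H0 Hseq f [Hf _]. rewrite !HB_norm_bloch_sup, H0. f_equal.
  unfold bloch_sup at 1. apply is_lub_Rbar_unique.
  destruct (Lub_Rbar_correct (fun r => exists z, unit_disc z /\ r = bloch_density f z)) as [Hub Hl].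
  split.
  - intros x [z [Hz ->]]. rewrite bloch_density_comp by assumption.
    apply Rbar_le_trans with (bloch_density f (phi z)).
    + assert (Ht := schwarz_pick phi z H Hz). assert (Hn := bloch_density_nonneg f (phi z) (proj1 H z Hz)). simpl. nra.
    + apply Hub. exists (phi z). split; auto. now apply H.
  - intros b Hb. apply Hl. intros x [a [Ha ->]].
    destruct (Hseq a Ha) as (z & Hz & Hlim & Htau).
    assert (Hlim' : is_lim_seq (fun n => bloch_density f (phi (z n))) (bloch_density f a)).
    { apply (filterlim_comp _ _ _ (fun n => phi (z n)) (bloch_density f) _ _ _ Hlim).
      apply (continuous_bloch_density f a Hf Ha). }
    assert (Hp := is_lim_seq_mult' _ _ _ _ Htau Hlim'). rewrite Rmult_1_l in Hp.
    assert (Hbn : forall n, Rbar_le (tau phi (z n) * bloch_density f (phi (z n))) b).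
    { intros n. apply Hb. exists (z n). split. apply Hz. symmetry. apply bloch_density_comp; auto. apply Hz. }
    destruct b as [b| |].
    + exact (is_lim_seq_le _ (fun _ => b) _ _ Hbn Hp (is_lim_seq_const b)).
    + exact I.
    + exact (Hbn O).
Qed.

Lemma is_lim_seq_intro (u : nat -> R) (l : R) :
  (forall e, 0 < e -> exists N, forall n, (N <= n)%nat -> Rabs (u n - l) < e) -> is_lim_seq u l.
Proof. intros H. apply is_lim_seq_Reals. intros e He. exact (H e He). Qed.

Lemma filterlim_C_intro (u : nat -> C) (l : C) :
  (forall e, 0 < e -> exists N, forall n, (N <= n)%nat -> Cmod (u n - l) < e) ->
  filterlim u eventually (@locally C_UniformSpace l).
Proof.
  intros H P HP. apply locally_C in HP. destruct HP as [d Hd].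
  destruct (H d (cond_pos d)) as [N HN]. exists N. intros n Hn. apply Hd. exact (HN n Hn).
Qed.

Lemma filterlim_C_elim (u : nat -> C) (l : C) (e : R) :
  filterlim u eventually (@locally C_UniformSpace l) -> 0 < e ->
  exists N, forall n, (N <= n)%nat -> Cmod (u n - l) < e.
Proof.
  intros H He. apply (H (fun w => Cmod (w - l) < e)). apply locally_C.
  exists (mkposreal e He). intros w Hw. exact Hw.
Qed.

Lemma is_lim_seq_elim (u : nat -> R) (l e : R) : is_lim_seq u l -> 0 < e ->
  exists N, forall n, (N <= n)%nat -> Rabs (u n - l) < e.
Proof. intros H He. apply is_lim_seq_Reals in H. exact (H e He). Qed.

Lemma rotation_isometry phi : holomorphic_self_map phi -> is_rotation phi ->
  phi 0 = 0 /\ composition_isometry phi.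
Proof.
  intros H [c [Hc E]].
  assert (H0 : phi 0 = 0) by (rewrite E by apply Cmod_lt_1_0; ring).
  split. exact H0. apply isometry_of_sequences; auto. intros a Ha.
  assert (Hw : Cmod (Cconj c * a) < 1) by (rewrite Cmod_mult, Cmod_conj, Hc, Rmult_1_l; exact Ha).
  assert (Ew : phi (Cconj c * a)%C = a).
  { rewrite E by exact Hw. transitivity ((Cconj c * c) * a)%C. ring. rewrite unimodular_inv by assumption. ring. }
  exists (fun _ => (Cconj c * a)%C). split. intros _. exact Hw. split.
  - rewrite Ew. apply filterlim_const.
  - replace (tau phi (Cconj c * a)%C) with 1. apply is_lim_seq_const.
    unfold tau. rewrite (cdiff_C_derive phi _ c), Ew, Cmod_mult, Cmod_conj, Hc.
    + pose proof (Cmod_sq_lt_1 a Ha). field. lra.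
    + set (w := (Cconj c * a)%C) in *.
      apply (cdiff_ext_loc (fun z => 0 + c * z)%C). 2: apply cdiff_affine.
      exists (1 - Cmod w). split. lra. intros z Hz. rewrite E. ring.
      unfold unit_disc. pose proof (Cmod_triangle_rev z w). lra.
Qed.

(** The density of [c + phi] does not depend on [c], so its supremum [s] satisfies
    [|c + phi 0| + s = |c| + 1] for every [c]. Taking [c = 0] and [c = - phi 0] gives
    [|phi 0| = - |phi 0|]. *)
Lemma isometry_fixes_0 phi : holomorphic_self_map phi -> composition_isometry phi -> phi 0 = 0.
Proof.
  intros H Hiso.
  assert (Ht : forall c : C, HB_norm (fun z => c + z)%C = Finite (Cmod c + 1)).
  { intros c. rewrite HB_norm_bloch_sup. rewrite (bloch_sup_unique _ 1).
    - simpl. do 2 f_equal. f_equal. ring.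
    - intros z Hz. rewrite bloch_density_translation. pose proof (pow2_ge_0 (Cmod z)). lra.
    - exists 0. split. apply Cmod_lt_1_0. rewrite bloch_density_translation, Cmod_0. ring. }
  assert (Hb : forall c : C, bloch_sup (fun z => c + phi z)%C = bloch_sup phi).
  { intros c. apply Lub_Rbar_eqset. intros x.
    assert (E : forall z, unit_disc z -> bloch_density (fun z => c + phi z)%C z = bloch_density phi z).
    { intros z Hz.
      assert (E1 := bloch_density_comp (fun z => c + z)%C phi z (harmonic_translation c) H Hz).
      assert (E2 := bloch_density_comp (fun z => 0 + z)%C phi z (harmonic_translation 0) H Hz).
      rewrite bloch_density_translation in E1, E2. cbv beta in E1, E2. rewrite E1, <- E2.
      unfold bloch_density. destruct (harmonic_comp_dz _ phi z (harmonic_translation 0) H Hz) as [-> ->].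
      destruct (cdiff_dz _ _ _ (proj2 H z Hz)) as [-> ->].
      assert (Hd : cdiff (fun z => 0 + z)%C (phi z) 1).
      { refine (cdiff_eq _ _ _ _ _ _ eq_refl (cdiff_id _)). intros w; ring. }
      destruct (cdiff_dz _ _ _ Hd) as [-> ->]. rewrite Cmult_0_l, Cmult_1_l. reflexivity. }
    split; intros [z [Hz ->]]; exists z; split; auto; now rewrite E. }
  assert (Hc : forall c : C, Rbar_plus (Cmod (c + phi 0)) (bloch_sup phi) = Finite (Cmod c + 1)).
  { intros c. rewrite <- (Hb c), <- Ht. apply (Hiso (fun z => c + z)%C).
    split. apply harmonic_translation. rewrite Ht. reflexivity. }
  assert (H1 := Hc 0). assert (H2 := Hc (- phi 0)%C).
  replace (- phi 0 + phi 0)%C with (RtoC 0) in H2 by ring. rewrite Cmod_opp in H2.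
  replace (0 + phi 0)%C with (phi 0) in H1 by ring. rewrite Cmod_0 in H1, H2.
  destruct (bloch_sup phi) as [s| |]; simpl in H1, H2; try discriminate.
  injection H1 as H1. injection H2 as H2. apply Cmod_eq_0. lra.
Qed.

(** The density of [mob a] has supremum 1, attained at [a]. As [phi 0 = 0], composition keeps the
    value at the origin, so equality of norms is equality of suprema, and the composite density
    comes arbitrarily close to 1. *)
Lemma isometry_test phi a e : holomorphic_self_map phi -> composition_isometry phi -> Cmod a < 1 -> 0 < e ->
  exists z, Cmod z < 1 /\ 1 - e < tau phi z * (1 - Cmod (mob a (phi z)) ^ 2).
Proof.
  intros H Hiso Ha He. assert (H0 := isometry_fixes_0 phi H Hiso).
  assert (Hn : HB_norm (mob a) = Finite (Cmod a + 1)).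
  { rewrite HB_norm_bloch_sup, mob_0, (bloch_sup_unique _ 1). reflexivity.
    - intros z Hz. rewrite bloch_density_mob by assumption. pose proof (pow2_ge_0 (Cmod (mob a z))). lra.
    - exists a. split. assumption. rewrite bloch_density_mob, mob_self, Cmod_0 by assumption. ring. }
  assert (Hh := harmonic_mob a Ha).
  assert (E := Hiso (mob a)). rewrite Hn, HB_norm_bloch_sup, H0, mob_0 in E.
  assert (Hs : bloch_sup (fun z => mob a (phi z)) = 1).
  { assert (E' : Rbar_plus (Cmod a) (bloch_sup (fun z => mob a (phi z))) = Finite (Cmod a + 1)).
    { apply E. split. assumption. rewrite Hn. reflexivity. }
    destruct (bloch_sup _) as [s| |]; simpl in E'; try discriminate.
    injection E' as E'. f_equal. lra. }
  destruct (bloch_sup_approx _ 1 e Hs He) as [z [Hz Hz']].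
  exists z. split. assumption.
  rewrite bloch_density_comp, bloch_density_mob in Hz' by (assumption || now apply H). exact Hz'.
Qed.

(** Both factors in [isometry_test] are at most 1, so a product close to 1 brings each of them close
    to 1. The first gives the limit of [tau]; the second sends [mob a (phi (z n))] to [0], that is,
    [phi (z n)] to [a]. *)
Lemma isometry_sequences phi a : holomorphic_self_map phi -> composition_isometry phi -> ~ is_rotation phi -> Cmod a < 1 ->
  exists z : nat -> C,
    (forall n, unit_disc (z n)) /\
    is_lim_seq (fun n => Cmod (z n)) 1 /\
    filterlim (fun n => phi (z n)) eventually (@locally C_UniformSpace a) /\
    is_lim_seq (fun n => tau phi (z n)) 1.
Proof.
  intros H Hiso Hrot Ha. assert (H0 := isometry_fixes_0 phi H Hiso).
  assert (Hlt : forall z, Cmod z < 1 -> tau phi z < 1).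
  { intros z Hz. destruct (Rle_lt_or_eq_dec _ _ (schwarz_pick phi z H Hz)) as [|E]. assumption.
    exfalso. apply Hrot. now apply (tau_1_rotation phi z). }
  assert (Hpos : forall n, 0 < / (INR n + 1)).
  { intros n. apply Rinv_0_lt_compat. pose proof (pos_INR n). lra. }
  set (z := fun n => proj1_sig (constructive_indefinite_description _ (isometry_test phi a _ H Hiso Ha (Hpos n)))).
  assert (Hz : forall n, Cmod (z n) < 1 /\ 1 - / (INR n + 1) < tau phi (z n) * (1 - Cmod (mob a (phi (z n))) ^ 2)).
  { intros n. unfold z. now destruct constructive_indefinite_description. }
  clearbody z.
  assert (Hsmall : forall e, 0 < e -> exists N, forall n, (N <= n)%nat -> / (INR n + 1) < e).
  { intros e He. destruct (archimed_cor1 e He) as [N [HN HN0]]. exists N. intros n Hn.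
    apply Rle_lt_trans with (2 := HN). apply Rinv_le_contravar. now apply lt_0_INR.
    apply le_INR in Hn. lra. }
  assert (Htau0 : forall w, Cmod w < 1 -> 0 <= tau phi w).
  { intros w Hw. unfold tau. pose proof (Cmod_sq_lt_1 _ (proj1 H w Hw)). pose proof (Cmod_sq_lt_1 w Hw).
    apply Rmult_le_pos. apply Rmult_le_pos. lra. apply Cmod_ge_0. apply Rlt_le, Rinv_0_lt_compat. lra. }
  assert (Hmob : forall n, Cmod (mob a (phi (z n))) < 1).
  { intros n. apply mob_disc. assumption. apply H, Hz. }
  assert (Htau : forall n, 1 - / (INR n + 1) < tau phi (z n)).
  { intros n. destruct (Hz n) as [Hn1 Hn2]. specialize (Htau0 _ Hn1).
    pose proof (pow2_ge_0 (Cmod (mob a (phi (z n))))). nra. }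
  exists z. split; [|split; [|split]].
  - intros n. apply Hz.
  - apply is_lim_seq_intro. intros e He.
    destruct (tau_gap phi (1 - e) H Hlt) as [eta [Heta Hgap]]. lra.
    destruct (Hsmall eta Heta) as [N HN]. exists N. intros n Hn. specialize (HN n Hn).
    destruct (Hz n) as [Hn1 _]. specialize (Htau n).
    destruct (Rle_lt_dec (Cmod (z n)) (1 - e)) as [Hle|Hgt].
    + specialize (Hgap _ Hle). lra.
    + apply Rabs_def1; lra.
  - apply filterlim_C_intro. intros e He.
    (* The square of [|mob a (phi (z n))|] is below [/ (INR n + 1)], and [a - phi (z n)] is this
       Moebius value times a denominator of modulus at most 2. *)
    destruct (Hsmall ((e / 2) ^ 2)) as [N HN]. apply pow_lt; lra.
    exists N. intros n Hn. specialize (HN n Hn). destruct (Hz n) as [Hn1 Hn2].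
    assert (Ht1 := schwarz_pick phi (z n) H Hn1). specialize (Htau0 _ Hn1).
    specialize (Hmob n). assert (Hp1 := proj1 H _ Hn1).
    assert (Em : phi (z n) = mob a (mob a (phi (z n)))) by (symmetry; now apply mob_involutive).
    assert (Hd := mob_den a (phi (z n)) Ha Hp1).
    assert (Es : (a - phi (z n))%C = (mob a (phi (z n)) * (1 - Cconj a * phi (z n)))%C).
    { unfold mob. field. assumption. }
    rewrite Cmod_minus_sym, Es, Cmod_mult.
    set (m := Cmod (mob a (phi (z n)))) in *. pose proof (Cmod_ge_0 (mob a (phi (z n)))) as Hm0. fold m in Hm0.
    assert (Hm : m < e / 2).
    { pose proof (Cmod_sq_lt_1 _ Hmob). fold m in H1. assert (m ^ 2 < (e / 2) ^ 2) by nra.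
      apply Rnot_le_lt. intros Hle. assert ((e / 2) ^ 2 <= m ^ 2) by (apply pow_incr; lra). lra. }
    assert (Hden : Cmod (1 - Cconj a * phi (z n)) <= 2).
    { eapply Rle_trans. apply Cmod_triangle_minus. rewrite Cmod_1, Cmod_mult, Cmod_conj.
      pose proof (Cmod_ge_0 a). pose proof (Cmod_ge_0 (phi (z n))). nra. }
    pose proof (Cmod_ge_0 (1 - Cconj a * phi (z n))). nra.
  - apply is_lim_seq_intro. intros e He. destruct (Hsmall e He) as [N HN]. exists N. intros n Hn.
    specialize (HN n Hn). specialize (Htau n). assert (Ht := Hlt _ (proj1 (Hz n))). apply Rabs_def1; lra.
Qed.

(** * Bounded derivative or univalence excludes sequences over the origin *)

(** Injectivity leaves [0] as the only zero of [phi], so the minimum of [|phi|] over the circle,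
    attained by compactness, is positive. *)
Lemma circle_lower_bound phi r : holomorphic_self_map phi -> univalent phi -> phi 0 = 0 -> 0 < r < 1 ->
  exists m, 0 < m /\ forall t, 0 <= t <= 2 * PI -> m <= Cmod (phi (cis r t)).
Proof.
  intros H Huni H0 Hr. pose proof PI_RGT_0.
  destruct (continuity_ab_min (fun t => Cmod (phi (cis r t))) 0 (2 * PI)) as [t0 [Hmin _]]. lra.
  - intros t _. apply continuity_pt_filterlim.
    apply (continuous_comp (U := R_UniformSpace) (V := C_UniformSpace) (cis r) (fun z => Cmod (phi z)) t).
    + apply (continuous_comp_2 (fun t => r * cos t) (fun t => r * sin t) (fun x y => (x, y) : C_UniformSpace)).
      apply (ex_derive_continuous (fun t => r * cos t)). auto_derive; auto.
      apply (ex_derive_continuous (fun t => r * sin t)). auto_derive; auto.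
      eapply continuous_ext. 2: apply continuous_id. now intros [x y].
    + apply continuous_Cmod_comp. eapply cdiff_ccont. apply H. rewrite Cmod_cis; lra.
  - exists (Cmod (phi (cis r t0))). split; [|exact Hmin].
    apply Cmod_gt_0. intros E.
    assert (Ec : cis r t0 = 0).
    { apply Huni. unfold unit_disc; rewrite Cmod_cis; lra. apply Cmod_lt_1_0. now rewrite E, H0. }
    assert (Hc : Cmod (cis r t0) = r) by (apply Cmod_cis; lra). rewrite Ec, Cmod_0 in Hc. lra.
Qed.

(* If the value [b = phi w] is small but taken outside the circle [|z| = 1/2], then
   [1 / (phi - b)] is holomorphic inside, and its value at [0] exceeds its circle mean. *)
Lemma univalent_small_values phi : holomorphic_self_map phi -> univalent phi -> phi 0 = 0 ->
  exists e, 0 < e /\ forall w, / 2 < Cmod w < 1 -> e <= Cmod (phi w).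
Proof.
  intros H Huni H0. destruct (circle_lower_bound phi (/ 2) H Huni H0) as [m [Hm Hlow]]. lra.
  (* If [|b| < m / 2], then [|phi - b| > m / 2] on the circle, so the mean of [1 / (phi - b)] is at
     most [2 / m], whereas its value at [0] has modulus [1 / |b| > 2 / m]. *)
  exists (m / 2). split. lra. intros w Hw. apply Rnot_lt_le. intros Hb.
  set (b := phi w) in *.
  assert (Hne : forall z, Cmod z < Cmod w -> (phi z - b)%C <> 0).
  { intros z Hz E. assert (Ez : z = w).
    { apply Huni; unfold unit_disc; try lra. fold b. apply Ceq_minus. exact E. }
    subst z. lra. }
  assert (Hb0 : (0 - b)%C <> 0). { rewrite <- H0 at 1. apply Hne. rewrite Cmod_0. lra. }
  assert (Hbpos : 0 < Cmod b).
  { apply Cmod_gt_0. intros E. apply Hb0. rewrite E. ring. }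
  destruct (exists_direction (/ (0 - b))) as (u & Hu & Hre & _).
  assert (Hg : forall z, Cmod z < Cmod w -> exists l, cdiff (fun z => Cconj u * / (phi z - b))%C z l).
  { intros z Hz. eexists. apply cdiff_scal. apply (cdiff_comp Cinv (fun z => phi z - b)%C).
    apply cdiff_inv, Hne, Hz. apply cdiff_minus. apply H. lra. apply cdiff_const. }
  assert (Hle := circle_mean_le (fun z => Cconj u * / (phi z - b))%C (Cmod w) (/ 2) (2 / m)).
  cbv beta in Hle. rewrite H0, Hre in Hle.
  assert (Hle' : Cmod (/ (0 - b)) <= 2 / m).
  { apply Hle.
    - intros z Hz. apply Hg. lra.
    - destruct (Hg 0) as [l Hl]. rewrite Cmod_0; lra. exact (cdiff_ccont _ _ _ Hl).
    - lra.
    - intros t Ht. specialize (Hlow t Ht).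
      assert (Hc : Cmod (cis (/ 2) t) = / 2) by (apply Cmod_cis; lra).
      eapply Rle_trans. apply Re_le_Cmod. rewrite Cmod_mult, Cmod_conj, Hu, Rmult_1_l.
      rewrite Cmod_inv by (apply Hne; lra).
      pose proof (Cmod_triangle_rev (phi (cis (/ 2) t)) b).
      replace (2 / m) with (/ (m / 2)) by (field; lra). apply Rinv_le_contravar; lra. }
  rewrite Cmod_inv in Hle' by assumption.
  replace (0 - b)%C with (- b)%C in Hle' by ring. rewrite Cmod_opp in Hle'.
  assert (Hlt : / (m / 2) < / Cmod b) by (apply Rinv_lt_contravar; nra).
  replace (/ (m / 2)) with (2 / m) in Hlt by (field; lra). lra.
Qed.

Lemma no_sequence_at_0 phi : holomorphic_self_map phi -> phi 0 = 0 ->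
  bounded_derivative phi \/ univalent phi ->
  ~ exists z : nat -> C,
    (forall n, unit_disc (z n)) /\
    is_lim_seq (fun n => Cmod (z n)) 1 /\
    filterlim (fun n => phi (z n)) eventually (@locally C_UniformSpace (RtoC 0)) /\
    is_lim_seq (fun n => tau phi (z n)) 1.
Proof.
  intros H H0 [[M HM]|Huni] (z & Hz & Hz1 & Hphi & Htau).
  - set (K := Rmax M 1). assert (HK : 1 <= K) by apply Rmax_r. assert (HMK : M <= K) by apply Rmax_l.
    (* Near the boundary [1 - |z| ^ 2] is then at most [2 / (8 * K)], so the numerator of [tau] is
       at most [1 / 4]; but [tau > 1 / 2] with denominator at least [1 / 2] would make it larger.
       Taking [K] at least 1 keeps it positive. *)
    assert (He : 0 < / (8 * K)) by (apply Rinv_0_lt_compat; lra).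
    destruct (is_lim_seq_elim _ _ _ Hz1 He) as [N1 HN1].
    destruct (filterlim_C_elim _ _ (/ 2) Hphi) as [N2 HN2]. lra.
    destruct (is_lim_seq_elim _ _ (/ 2) Htau) as [N3 HN3]. lra.
    set (n := (N1 + N2 + N3)%nat).
    specialize (HN1 n ltac:(unfold n; lia)). specialize (HN2 n ltac:(unfold n; lia)). specialize (HN3 n ltac:(unfold n; lia)).
    specialize (Hz n). specialize (HM _ Hz). unfold unit_disc in Hz.
    replace (phi (z n) - 0)%C with (phi (z n)) in HN2 by ring.
    apply Rabs_def2 in HN1. apply Rabs_def2 in HN3.
    pose proof (Cmod_ge_0 (z n)). pose proof (Cmod_ge_0 (phi (z n))). pose proof (Cmod_ge_0 (C_derive phi (z n))).
    assert (Hden : 1 / 2 <= 1 - Cmod (phi (z n)) ^ 2) by nra.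
    assert (Hnum : (1 - Cmod (z n) ^ 2) * Cmod (C_derive phi (z n)) <= 1 / 4).
    { assert (A : 1 - Cmod (z n) ^ 2 <= 2 * / (8 * K)) by nra.
      assert (0 <= 1 - Cmod (z n) ^ 2) by nra.
      apply Rle_trans with (2 * / (8 * K) * K). apply Rmult_le_compat; lra.
      right. field. lra. }
    assert (Ht : 1 / 2 < tau phi (z n)) by lra. unfold tau in Ht.
    apply Rmult_lt_compat_r with (r := 1 - Cmod (phi (z n)) ^ 2) in Ht. 2: lra.
    unfold Rdiv at 2 in Ht. rewrite Rmult_assoc, Rinv_l in Ht by lra. lra.
  - destruct (univalent_small_values phi H Huni H0) as [e [He Hlow]].
    destruct (is_lim_seq_elim _ _ (/ 2) Hz1) as [N1 HN1]. lra.
    destruct (filterlim_C_elim _ _ e Hphi He) as [N2 HN2].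
    specialize (HN1 (N1 + N2)%nat ltac:(lia)). specialize (HN2 (N1 + N2)%nat ltac:(lia)).
    replace (phi (z (N1 + N2)%nat) - 0)%C with (phi (z (N1 + N2)%nat)) in HN2 by ring.
    apply Rabs_def2 in HN1. specialize (Hz (N1 + N2)%nat). unfold unit_disc in Hz.
    specialize (Hlow (z (N1 + N2)%nat)). lra.
Qed.

Theorem theorem2p1 (phi : C -> C) (hphi : analytic_self_map phi) :
  (composition_isometry phi <->
     phi 0 = 0 /\
     (is_rotation phi \/
      forall a : C, unit_disc a ->
        exists z : nat -> C,
          (forall n, unit_disc (z n)) /\
          is_lim_seq (fun n => Cmod (z n)) 1 /\
          filterlim (fun n => phi (z n)) eventually
            (@locally C_UniformSpace a) /\
          is_lim_seq (fun n => tau phi (z n)) 1)) /\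
  (bounded_derivative phi \/ univalent phi ->
     (composition_isometry phi <-> is_rotation phi)).
Proof.
  assert (H := analytic_holomorphic phi hphi).
  split.
  - split.
    + intros Hiso. split. now apply isometry_fixes_0.
      destruct (classic (is_rotation phi)) as [Hrot|Hrot]; [now left|right].
      intros a Ha. now apply isometry_sequences.
    + intros [H0 [Hrot|Hseq]]. now apply rotation_isometry.
      apply isometry_of_sequences; auto. intros a Ha.
      destruct (Hseq a Ha) as (z & Hz & _ & Hphi & Htau). exists z. auto.
  - intros Hbu. split.
    + intros Hiso. assert (H0 := isometry_fixes_0 phi H Hiso).
      apply NNPP. intros Hrot. apply (no_sequence_at_0 phi H H0 Hbu).
      apply isometry_sequences; auto. apply Cmod_lt_1_0.
    + intros Hrot. now apply rotation_isometry.
Qed.
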